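(* Let $T>0$, $d\in\mathbb{N}$, $g\in\mathbb{R}^d$, let $f:[0,T]\to\mathbb{R}^d$ be absolutely continuous with $f'\in L^2(0,T;\mathbb{R}^d)$, let $F:\mathbb{R}^d\to\mathbb{R}^d$ be of class $C^3$, and assume that the initial value problem $y'=F(y)+f(t)$, $t\in(0,T]$, $y(0)=g$, has a unique solution $y_*$ in $X=H^1(0,T;\mathbb{R}^d)$. Let $\{X^h\subset X\}$ be a sequence of finite element subspaces spanned by piecewise linear basis functions, with $h$ the maximal element length, such that $\lim_{h\to0}\|v-\Pi_h v\|_X=0$ for all $v\in X$. Assume that $$\sup_{t\in[0,T]}\|\mathrm{D}F(y_*(t))\|_{\mathrm{op}}<\frac{1}{\sqrt{2T^2+T+\widetilde{\mathfrak C}^2+\sqrt{(2T^2+T+\widetilde{\mathfrak C}^2)^2+2T\widetilde{\mathfrak C}^2(1+2T)}}}.$$ Let $r>0$, and let $\overline h>0$ be such that for each $h\in(0,\overline h)$ the problem of minimizing $J$ over $X^h$ has a unique solution $y_*^h$ in the open ball $B(y_*,r)\subset X$. Let $\mathfrak B=\bigcup_{t\in[0,T]}\{p\in\mathbb{R}^d:\|p-y_*(t)\|<\mathfrak C\,r\}$, and assume that $\mathrm{Lip}(F|_{\mathfrak B})\,T/\sqrt2<1$ and $\sup_{z\in\mathfrak B}\|\mathrm{D}F(z)\|_{\mathrm{op}}<1/\widetilde{\mathfrak C}$. For $h\in(0,\overline h)$ let $w_*[y_*^h]$ be the solution of $w'=F(y_*^h(t))+f(t)$, $t\in(0,T]$,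 $w(0)=g$, and let $w_*^h[y_*^h]$ be the least-squares finite element solution of this problem in $X^h$, i.e. the unique minimizer over $w^h\in X^h$ of $\tfrac12\|(w^h)'-F(y_*^h)-f\|^2_{L^2(0,T;\mathbb{R}^d)}+\tfrac12\|w^h(0)-g\|^2$ (equivalently $w_*^h[y_*^h]=\Pi_h w_*[y_*^h]$). Then there exists a constant $C>0$ independent of $h$ such that for all $h\in(0,\overline h)$ $$\|y_*^h-w_*^h[y_*^h]\|_X\le\frac{C\,\|(w_*[y_*^h])''\|_{L^2(0,T;\mathbb{R}^d)}}{1-\widetilde{\mathfrak C}\sup_{z\in\mathfrak B}\|\mathrm{D}F(z)\|_{\mathrm{op}}}\,h^2.$$
   Context: $\|\cdot\|$ is the Euclidean norm on $\mathbb{R}^d$, $\langle\cdot,\cdot\rangle$ the dot product, $\|\cdot\|_{\mathrm{op}}$ the induced operator norm of $d\times d$ matrices, and $\mathrm{D}F$ the Jacobian matrix of $F$. The space $X=H^1(0,T;\mathbb{R}^d)$ (elements identified with their continuous representatives) carries the inner product $\langle u,v\rangle_X=\int_0^T\langle u'(t),v'(t)\rangle\,dt+\langle u(0),v(0)\rangle$ and the induced norm $\|\cdot\|_X$, which is equivalent to the usual $H^1$ norm. A function $y\in X$ is a (strong) solution of the initial value problem if $y(0)=g$ and $y'=F(y)+f$ a.e. on $(0,T)$. $\mathfrak C$ is the smallest constant with $\max_{t\in[0,T]}\|u(t)\|\le\mathfrak C\|u\|_X$ for all $u\in X$, and $\widetilde{\mathfrak C}$ is the smallest constant with $\|u\|_{L^2(0,T;\mathbb{R}^d)}\le\widetilde{\mathfrak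 C}\|u\|_X$ for all $u\in X$. The objective function is $J(y)=\tfrac12\|y'-F(y)-f\|^2_{L^2(0,T;\mathbb{R}^d)}+\tfrac12\|y(0)-g\|^2$, $y\in X$. ''Spanned by piecewise linear basis functions'' means: $X^h$ is the space of all continuous functions $[0,T]\to\mathbb{R}^d$ that are affine on each element of a partition $0=t_0<\dots<t_N=T$ with maximal element length $h$. $\Pi_h:X\to X^h$ is the orthogonal projection with respect to $\langle\cdot,\cdot\rangle_X$. $\mathrm{Lip}(F|_{\mathfrak B})$ is the Lipschitz constant of $F$ restricted to $\mathfrak B$. $B(y_*,r)$ is the open ball in $X$ for $\|\cdot\|_X$. Statements ''for $h\in(0,\overline h)$'' refer to the members $X^h$ of the sequence with mesh size in $(0,\overline h)$. *)

(* Defs.v *)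
From HB Require Import structures.
From mathcomp Require Import all_boot all_order all_algebra.
From mathcomp Require Import all_classical all_reals all_analysis.


Import Order.TTheory GRing.Theory Num.Theory.
Import numFieldNormedType.Exports.

Local Open Scope classical_set_scope.
Local Open Scope ring_scope.

(* Vectors of R^d are row vectors 'rV[R]_d. The norm that the library puts on
   'rV[R]_d is the max norm; it is used below only through the topology it
   induces, and the Euclidean norm is [enorm]. *)

Definition dot {R : realType} {d : nat} (x y : 'rV[R]_d) : R :=
  \sum_(i < d) x ord0 i * y ord0 i.

Definition enorm {R : realType} {d : nat} (x : 'rV[R]_d) : R :=
  Num.sqrt (dot x x).

(* Matrices act on row vectors from the right; in particular the library's
   Jacobian satisfies 'D_v F x = v *m 'J F x, i.e. it is the transpose of the
   Jacobian matrix acting on column vectors. *)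
Definition opnorm {R : realType} {d : nat} (A : 'M[R]_d) : R :=
  sup [set enorm (v *m A) | v in [set v : 'rV[R]_d | enorm v <= 1]].

Fixpoint class_C {R : realType} {d : nat} (k : nat) (F : 'rV[R]_d -> 'rV[R]_d)
    : Prop :=
  if k is k'.+1 then
    (forall x, differentiable F x) /\
    (forall v, class_C k' (fun x => 'D_v F x))
  else continuous F.

(* Finite when F is C^1 and A is bounded (as a sup of reals, it would
   otherwise default to 0); likewise for the infimum in [lip]. *)
Definition sup_jac {R : realType} {d : nat} (F : 'rV[R]_d -> 'rV[R]_d)
    (A : set 'rV[R]_d) : R :=
  sup [set opnorm ('J F z) | z in A].

Definition lip {R : realType} {d : nat} (F : 'rV[R]_d -> 'rV[R]_d)
    (A : set 'rV[R]_d) : R :=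
  inf [set k : R | 0 <= k /\
    forall x y, A x -> A y -> enorm (F x - F y) <= k * enorm (x - y)].

(* Functions on [0, T] are total functions R -> 'rV[R]_d of which only the
   values on [0, T] matter: every notion below depends on these values only,
   and "unique" means unique up to equality on [0, T]. *)

Definition unique_on {R : realType} {d : nat} (T : R)
    (P : set (R -> 'rV[R]_d)) (u : R -> 'rV[R]_d) : Prop :=
  P u /\ forall v, P v -> {in `[0, T], v =1 u}.

Definition abs_continuous {R : realType} {d : nat} (T : R) (u : R -> 'rV[R]_d)
    : Prop :=
  forall e : R, 0 < e -> exists2 delta : R, 0 < delta &
    forall (n : nat) (a b : 'I_n -> R),
      (forall i, 0 <= a i /\ a i <= b i /\ b i <= T) ->
      trivIset setT (fun i => `]a i, b i[%classic) ->
      \sum_(i < n) (b i - a i) < delta ->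
      \sum_(i < n) enorm (u (b i) - u (a i)) < e.

Definition in_L2 {R : realType} {d : nat} (T : R) (v : R -> 'rV[R]_d) : Prop :=
  (forall i, measurable_fun `]0, T[ (fun t => v t ord0 i)) /\
  (\int[lebesgue_measure]_(t in `]0%R, T[) ((enorm (v t)) ^+ 2)%:E < +oo)%E.

Definition norm_L2 {R : realType} {d : nat} (T : R) (v : R -> 'rV[R]_d) : R :=
  Num.sqrt (\int[lebesgue_measure]_(t in `]0, T[) (enorm (v t)) ^+ 2).

(* H^1(0, T; R^d), each class being represented by its continuous
   representative: the absolutely continuous functions on [0, T] whose
   derivative, which exists almost everywhere, is in L^2. *)
Definition in_H1 {R : realType} {d : nat} (T : R) (u : R -> 'rV[R]_d) : Prop :=
  [/\ abs_continuous T u,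
      {ae lebesgue_measure, forall t, t \in `]0, T[ -> derivable u t 1} &
      in_L2 T (derive1 u)].

Definition dot_X {R : realType} {d : nat} (T : R) (u v : R -> 'rV[R]_d) : R :=
  \int[lebesgue_measure]_(t in `]0, T[) dot (derive1 u t) (derive1 v t)
  + dot (u 0) (v 0).

Definition norm_X {R : realType} {d : nat} (T : R) (u : R -> 'rV[R]_d) : R :=
  Num.sqrt (dot_X T u u).

Definition ball_X {R : realType} {d : nat} (T : R) (u : R -> 'rV[R]_d) (r : R)
    : set (R -> 'rV[R]_d) :=
  [set v | in_H1 T v /\ norm_X T (v - u) < r].

(* The smallest constants: both sets are closed, hence the infima are minima. *)
Definition const_max {R : realType} (d : nat) (T : R) : R :=
  inf [set c : R | 0 <= c /\ forall u : R -> 'rV[R]_d, in_H1 T u ->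
    forall t, t \in `[0, T] -> enorm (u t) <= c * norm_X T u].

Definition const_L2 {R : realType} (d : nat) (T : R) : R :=
  inf [set c : R | 0 <= c /\ forall u : R -> 'rV[R]_d, in_H1 T u ->
    norm_L2 T u <= c * norm_X T u].

(* u is the strong solution of u' = G on (0, T), u(0) = g. *)
Definition strong_solution {R : realType} {d : nat} (T : R) (g : 'rV[R]_d)
    (G : R -> 'rV[R]_d) (u : R -> 'rV[R]_d) : Prop :=
  [/\ in_H1 T u, u 0 = g &
      {ae lebesgue_measure, forall t, t \in `]0, T[ -> derive1 u t = G t}].

(* Partitions 0 = t_0 < ... < t_N = T are encoded by s = [:: t_1; ...; t_N]
   with itv_partition 0 T s, as in the library. *)
Definition node {R : realType} (s : seq R) (i : nat) : R := nth 0 (0 :: s) i.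

Definition mesh {R : realType} (s : seq R) : R :=
  \big[Num.max/0]_(i < size s) (node s i.+1 - node s i).

Definition fe_space {R : realType} (d : nat) (T : R) (s : seq R)
    : set (R -> 'rV[R]_d) :=
  [set u | {within `[0, T], continuous u} /\
    forall i, (i < size s)%N -> exists a b : 'rV[R]_d,
      forall t, t \in `[node s i, node s i.+1] -> u t = a + t *: b].

(* Orthogonal projection onto the finite-dimensional space [fe_space d T s];
   it exists and is unique up to equality on [0, T]. *)
Definition proj_fe {R : realType} {d : nat} (T : R) (s : seq R)
    (v : R -> 'rV[R]_d) : R -> 'rV[R]_d :=
  xget v [set p | fe_space d T s p /\
    forall z, fe_space d T s z -> dot_X T (v - p) z = 0].

Definition minimizer_on {R : realType} {d : nat} (A : set (R -> 'rV[R]_d))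
    (Phi : (R -> 'rV[R]_d) -> R) (u : R -> 'rV[R]_d) : Prop :=
  A u /\ forall v, A v -> Phi u <= Phi v.

(* Least-squares functional of the linear problem w' = F(z) + f, w(0) = g. *)
Definition J_lin {R : realType} {d : nat} (T : R) (F : 'rV[R]_d -> 'rV[R]_d)
    (f : R -> 'rV[R]_d) (g : 'rV[R]_d) (z w : R -> 'rV[R]_d) : R :=
  2^-1 * (norm_L2 T (fun t => derive1 w t - F (z t) - f t)) ^+ 2
  + 2^-1 * (enorm (w 0 - g)) ^+ 2.

Definition J {R : realType} {d : nat} (T : R) (F : 'rV[R]_d -> 'rV[R]_d)
    (f : R -> 'rV[R]_d) (g : 'rV[R]_d) (y : R -> 'rV[R]_d) : R :=
  2^-1 * (norm_L2 T (fun t => derive1 y t - F (y t) - f t)) ^+ 2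
  + 2^-1 * (enorm (y 0 - g)) ^+ 2.

Definition tube {R : realType} {d : nat} (T : R) (y : R -> 'rV[R]_d) (rho : R)
    : set 'rV[R]_d :=
  \bigcup_(t in `[0, T]) [set p | enorm (p - y t) < rho].

(* Main.v *)
Require Import Defs.
From HB Require Import structures.
From mathcomp Require Import all_boot all_order all_algebra.
From mathcomp Require Import all_classical all_reals all_analysis.
From mathcomp Require Import measurable_realfun ring lra.

Import Order.TTheory GRing.Theory Num.Theory.
Import numFieldNormedType.Exports.

Local Open Scope classical_set_scope.
Local Open Scope ring_scope.

(* Write y = y_*^h, w = w_*[y], wh = w_*^h[y], e = y - wh and G = F(y) + f = w'.
   Subtracting the first-order conditions of the two minimization problems, tested
   with e, gives
     |e|_X^2 = int <e', DF(y)e> + int <wh' - G, DF(y)e>.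
   The first integral is at most L |e'| |e|_{L^2} <= L C~ |e|_X^2, where L is the
   supremum of |DF| on the tube. Testing the linear condition with ramps shows that
   the residual wh' - G has mean zero on every element; as wh' is constant there, the
   residual is bounded by the oscillation of G, that is by h^{1/2} |w''|_{L^2} on the
   element. Since it has mean zero, DF(y)e may be replaced by its oscillation, which
   is O(h (|y'| |e|_oo + |e'|)). Summing over the elements bounds the second integral
   by a constant times h^2 |w''| |e|_X. *)

(** Why the order is two: on an element of length h_k the residual brings h_k^{1/2} times the L^2
    norm of w'', the oscillation of DF(y)e brings h_k times the values of |y'| and |e'|, and the
    integration brings h_k. As y' and e' are constant there, a factor h_k^{1/2} turns their values
    into L^2 norms; h_k^2 remains, and Cauchy-Schwarz over the elements closes the sum. The constant
    is independent of h because y enters it only through the ball: membership puts y(t) in the tube,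
    where DF is bounded and Lipschitz, and bounds |y'| in L^2. Since |e|_oo is at most [const_max]
    times |e|_X, one factor |e|_X cancels, and absorbing the first integral on the left produces the
    denominator. The technical obstacle is that measurability means Borel measurability and that
    [derive1] takes arbitrary values where no derivative exists. An almost everywhere identity
    between derivatives therefore carries no measurability along; this is why the fundamental
    theorem for absolutely continuous functions is stated with an arbitrary measurable
    representative of the derivative. *)

(** * Cauchy-Schwarz, the Euclidean norm and the operator norm *)

(** Evaluate the quadratic at its minimum [- B / C]; if [C = 0] it is affine, and a nonzero [B]
    would make it take the value -1. Both Cauchy-Schwarz inequalities below, for sums and for
    integrals, come from this. *)
Lemma discriminant_le {R : realType} (A B C : R) : 0 <= A -> 0 <= C ->
  (forall l : R, 0 <= A + l * B *+ 2 + l ^+ 2 * C) ->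
  `|B| <= Num.sqrt A * Num.sqrt C.
Proof.
move=> A0 C0 h; rewrite -sqrtrM// -sqrtr_sqr ler_wsqrtr//.
have [C_0|C_neq0] := eqVneq C 0.
  have [->|B0] := eqVneq B 0; first by rewrite expr0n mulr_ge0.
  have := h (- (A + 1) / (2 * B)).
  rewrite C_0 mulr0 addr0.
  have -> : - (A + 1) / (2 * B) * B *+ 2 = - (A + 1) by field.
  by rewrite opprD addrA subrr add0r lerNr oppr0 ler10.
have C1 : 0 < C by rewrite lt_neqAle eq_sym C_neq0.
have := h (- B / C).
have -> : A + - B / C * B *+ 2 + (- B / C) ^+ 2 * C = (A * C - B ^+ 2) / C.
  by rewrite -mulr_natl; field.
by rewrite pmulr_lge0 ?invr_gt0// subr_ge0.
Qed.

Lemma sum_cauchy_schwarz {R : realType} {I : finType} (a b : I -> R) :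
  `|\sum_i a i * b i| <=
    Num.sqrt (\sum_i a i ^+ 2) * Num.sqrt (\sum_i b i ^+ 2).
Proof.
apply: discriminant_le; [by apply: sumr_ge0 => i _; exact: sqr_ge0..|].
move=> l; rewrite mulr_sumr -sumrMnl mulr_sumr -!big_split/=.
apply: sumr_ge0 => i _.
rewrite (_ : _ + _ = (a i + l * b i) ^+ 2) ?sqr_ge0//.
by rewrite -mulr_natl; ring.
Qed.

Section euclidean.
Context {R : realType} {d : nat}.
Implicit Types (x y : 'rV[R]_d) (A : 'M[R]_d).

Lemma dotC x y : dot x y = dot y x.
Proof. by apply: eq_bigr => i _; rewrite mulrC. Qed.

Lemma dotDl x y z : dot (x + y) z = dot x z + dot y z.
Proof. by rewrite -big_split; apply: eq_bigr => i _; rewrite mxE mulrDl. Qed.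

Lemma dotZl k x y : dot (k *: x) y = k * dot x y.
Proof. by rewrite mulr_sumr; apply: eq_bigr => i _; rewrite mxE mulrA. Qed.

Lemma dotNl x y : dot (- x) y = - dot x y.
Proof. by rewrite -scaleN1r dotZl mulN1r. Qed.

Lemma dotBl x y z : dot (x - y) z = dot x z - dot y z.
Proof. by rewrite dotDl dotNl. Qed.

Lemma dotDr x y z : dot z (x + y) = dot z x + dot z y.
Proof. by rewrite dotC dotDl !(dotC z). Qed.

Lemma dotZr k x y : dot y (k *: x) = k * dot y x.
Proof. by rewrite dotC dotZl dotC. Qed.

Lemma dotNr x y : dot y (- x) = - dot y x.
Proof. by rewrite dotC dotNl dotC. Qed.

Lemma dotBr x y z : dot z (x - y) = dot z x - dot z y.
Proof. by rewrite dotDr dotNr. Qed.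

Lemma dot0l x : dot 0 x = 0.
Proof. by rewrite -(scale0r 0) dotZl mul0r. Qed.

Lemma dotxx_ge0 x : 0 <= dot x x.
Proof. by apply: sumr_ge0 => i _; rewrite -expr2 sqr_ge0. Qed.

Lemma enorm_ge0 x : 0 <= enorm x.
Proof. exact: sqrtr_ge0. Qed.

Lemma sqr_enorm x : enorm x ^+ 2 = dot x x.
Proof. exact/sqr_sqrtr/dotxx_ge0. Qed.

Lemma sqr_enormE x : enorm x ^+ 2 = \sum_i x ord0 i ^+ 2.
Proof. by rewrite sqr_enorm; apply: eq_bigr => i _; rewrite expr2. Qed.

Lemma enorm0 : enorm (0 : 'rV[R]_d) = 0.
Proof. by rewrite /enorm dot0l sqrtr0. Qed.

Lemma abs_dot_le x y : `|dot x y| <= enorm x * enorm y.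
Proof.
by rewrite (le_trans (sum_cauchy_schwarz _ _))// /enorm /dot;
  under eq_bigr do rewrite expr2; under [in X in _ * X]eq_bigr do rewrite expr2.
Qed.

Lemma enormD x y : enorm (x + y) <= enorm x + enorm y.
Proof.
rewrite -(@ler_pXn2r _ 2)// ?nnegrE ?addr_ge0 ?enorm_ge0//.
rewrite sqr_enorm dotDl !dotDr sqrrD !sqr_enorm (dotC y x).
have := le_trans (ler_norm _) (abs_dot_le x y).
by move=> ?; rewrite -mulr_natl; lra.
Qed.

Lemma enormZ k x : enorm (k *: x) = `|k| * enorm x.
Proof.
by rewrite /enorm dotZl dotZr mulrA -expr2 sqrtrM ?sqr_ge0// sqrtr_sqr.
Qed.

Lemma enormN x : enorm (- x) = enorm x.
Proof. by rewrite -scaleN1r enormZ normrN1 mul1r. Qed.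

Lemma enorm_distC x y : enorm (x - y) = enorm (y - x).
Proof. by rewrite -opprB enormN. Qed.

Lemma enorm_sum {I : finType} (f : I -> 'rV[R]_d) :
  enorm (\sum_i f i) <= \sum_i enorm (f i).
Proof.
elim/big_ind2 : _ => //; first by rewrite enorm0.
by move=> a b c e ab ce; rewrite (le_trans (enormD _ _))// lerD.
Qed.

Lemma abs_coord_le_enorm x i : `|x ord0 i| <= enorm x.
Proof.
rewrite -sqrtr_sqr ler_wsqrtr// /dot (bigD1 i)//= expr2 lerDl.
by apply: sumr_ge0 => j _; rewrite -expr2 sqr_ge0.
Qed.

Lemma enorm_le_sum x : enorm x <= \sum_i `|x ord0 i|.
Proof.
rewrite -(@ler_pXn2r _ 2)// ?nnegrE ?enorm_ge0 ?sumr_ge0//.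
rewrite sqr_enormE expr2 mulr_suml ler_sum// => i _.
rewrite -real_normK ?num_real// expr2.
by rewrite ler_wpM2l// (bigD1 i)//= lerDl sumr_ge0.
Qed.

Lemma enorm_eq0 x : enorm x = 0 -> x = 0.
Proof.
move=> x0; apply/rowP => i; rewrite mxE; apply/eqP; rewrite -normr_le0 -x0.
exact: abs_coord_le_enorm.
Qed.

(** With [enorm_le_norm], this links the Euclidean norm to the max norm, in which the library
    expresses compactness and limits. *)
Lemma normr_le_enorm x : `|x| <= enorm x.
Proof.
have [->|x0] := eqVneq x 0; first by rewrite normr0 enorm_ge0.
rewrite /Num.norm/=.
have := @mx_norm_neq0 _ _ _ x; case.
  by apply: contra_neqN x0 => /eqP/mx_norm_eq0.
by move=> [i j]/= ->; rewrite (ord1 i) abs_coord_le_enorm.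
Qed.

Lemma abs_coord_le_norm x i : `|x ord0 i| <= `|x|.
Proof.
rewrite /Num.norm/= mx_normrE.
exact: (le_bigmax _ (fun ij : 'I_1 * 'I_d => `|x ij.1 ij.2|) (ord0, i)).
Qed.

Lemma enorm_le_norm x : enorm x <= d%:R * `|x|.
Proof.
rewrite (le_trans (enorm_le_sum x))// -[X in X%:R]card_ord -sum1_card natr_sum.
by rewrite mulr_suml ler_sum// => i _; rewrite mul1r abs_coord_le_norm.
Qed.

(** A crude bound whose purpose is that the set under the supremum in [opnorm] is bounded above, so
    that the supremum is a genuine one. *)
Lemma enorm_mulmx_le v A :
  enorm (v *m A) <= (\sum_i enorm (row i A)) * enorm v.
Proof.
rewrite mulmx_sum_row (le_trans (enorm_sum _))// mulr_suml ler_sum// => i _.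
by rewrite enormZ mulrC ler_wpM2l ?enorm_ge0// abs_coord_le_enorm.
Qed.

Lemma opnorm_le A k : 0 <= k ->
  (forall v, enorm (v *m A) <= k * enorm v) -> opnorm A <= k.
Proof.
move=> k0 h; apply: ge_sup.
  by exists 0, 0; rewrite /= ?mul0mx ?enorm0 ?ler01.
by move=> _ [v /= v1 <-]; rewrite (le_trans (h v))// ler_piMr.
Qed.

Lemma enorm_mulmx_opnorm v A : enorm (v *m A) <= opnorm A * enorm v.
Proof.
have [/enorm_eq0 ->|v0] := eqVneq (enorm v) 0.
  by rewrite mul0mx !enorm0 mulr0.
have vp : 0 < enorm v by rewrite lt_neqAle eq_sym v0 enorm_ge0.
rewrite -ler_pdivrMr//.
apply: ub_le_sup.
  exists (\sum_i enorm (row i A)) => _ [u /= u1 <-].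
  rewrite (le_trans (enorm_mulmx_le _ _))// ler_piMr//.
  by rewrite sumr_ge0// => i _; exact: enorm_ge0.
exists ((enorm v)^-1 *: v) => /=.
  by rewrite enormZ ger0_norm ?invr_ge0 ?enorm_ge0// mulVf.
by rewrite -scalemxAl enormZ ger0_norm ?invr_ge0 ?enorm_ge0// mulrC.
Qed.

End euclidean.

(** * Maps of class C^1 and C^2 *)

Section differentiable_maps.
Context {R : realType} {d : nat}.
Implicit Types (f : 'rV[R]_d -> 'rV[R]_d) (x v : 'rV[R]_d).

(** The Euclidean ball lies in the closed max-norm ball of the same radius, which is compact. *)
Lemma bounded_continuous_ball f (rho : R) : continuous f ->
  exists2 M : R, 0 <= M & forall x, enorm x <= rho -> enorm (f x) <= M.
Proof.
move=> cf.
have cB : compact [set x : 'rV[R]_d | `|x| <= rho].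
  apply: bounded_closed_compact.
    exists rho; split; first exact: num_real.
    by move=> M /ltW rM x /= /le_trans; exact.
  have -> : [set x : 'rV[R]_d | `|x| <= rho] =
    Num.norm @^-1` [set r : R | r <= rho] by [].
  apply: closed_comp; last exact: closed_le.
  by move=> ? _; exact: norm_continuous.
have /compact_bounded[M0 [_ hM]] : compact (f @` [set x | `|x| <= rho]).
  by apply: continuous_compact => //; exact: continuous_subspaceT.
pose M := `|M0| + 1.
have M0M : M0 < M by rewrite (le_lt_trans (ler_norm _))// ltrDl.
exists (d%:R * M); first by rewrite mulr_ge0// addr_ge0.
move=> x xr; rewrite (le_trans (enorm_le_norm _))// ler_wpM2l//.
by apply: hM M0M _ _; exists x => //=; exact: le_trans (normr_le_enorm _) xr.
Qed.

Lemma is_derive_line (k : 'rV[R]_d -> R) x v (t : R) :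
  derivable k (x + t *: v) v ->
  is_derive t 1 (fun t => k (x + t *: v)) ('D_v k (x + t *: v)).
Proof.
move=> dk.
have E : (fun h : R => h^-1 *: (((fun t => k (x + t *: v)) \o shift t) (h *: 1)
    - k (x + t *: v))) =
  (fun h => h^-1 *: ((k \o shift (x + t *: v)) (h *: v) - k (x + t *: v))).
  apply/funext => h /=; congr (_ *: (k _ - _)).
  by rewrite [h *: 1]mulr1 scalerDl addrCA.
by split; rewrite /derivable /derive E.
Qed.

(** The intermediate point depends on the coordinate [j]. Estimates derived from this are therefore
    made coordinate by coordinate and summed, which is where their factor [d] comes from. *)
Lemma MVT_coord f x v (j : 'I_d) : (forall x, differentiable f x) ->
  exists2 th : R, 0 <= th <= 1 &
    f (x + v) ord0 j - f x ord0 j = ('D_v f (x + th *: v)) ord0 j.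
Proof.
move=> df.
have dfv y : derivable f y v by exact: diff_derivable.
pose k y := f y ord0 j.
have dk y : derivable k y v by exact: (derivable_mxP _ _ _).1.
have Dk y : 'D_v k y = ('D_v f y) ord0 j by rewrite derive_mx// mxE.
have isd (t : R) : is_derive t 1 (fun t => k (x + t *: v)) ('D_v k (x + t *: v)).
  exact: is_derive_line.
have cg : {within `[0, 1], continuous (fun t : R => k (x + t *: v))}.
  by apply: derivable_within_continuous => t _; case: (isd t).
have [th th01] := @MVT_segment R _ (fun t => 'D_v k (x + t *: v)) 0 1 ler01
  (fun t _ => isd t) cg.
rewrite scale1r scale0r addr0 subr0 mulr1 Dk => E.
by exists th.
Qed.

Definition differentiable_C1 f :=
  (forall x, differentiable f x) /\ (forall v, continuous (fun x => 'D_v f x)).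

(** The expansion in partial derivatives turns statements about finitely many fixed directions into
    bounds uniform in [v], and yields measurability when the direction varies with time. *)
Lemma derive_coordE f x v : differentiable f x ->
  'D_v f x = \sum_i v ord0 i *: 'D_(delta_mx ord0 i) f x.
Proof.
move=> df; rewrite deriveEjacobian// mulmx_sum_row; apply: eq_bigr => i _.
by rewrite deriveEjacobian// rowE.
Qed.

Lemma derive_bounded f (rho : R) : differentiable_C1 f ->
  exists2 K : R, 0 <= K &
    forall x v, enorm x <= rho -> enorm ('D_v f x) <= K * enorm v.
Proof.
move=> [df cf].
have /choice[M hM] : forall i : 'I_d, exists M : R, 0 <= M /\
    forall x, enorm x <= rho -> enorm ('D_(delta_mx ord0 i) f x) <= M.
  move=> i; have [M M0 hM] := bounded_continuous_ball _ rho (cf (delta_mx ord0 i)).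
  by exists M.
exists (\sum_i M i); first by apply: sumr_ge0 => i _; case: (hM i).
move=> x v xr; rewrite derive_coordE// (le_trans (enorm_sum _))//.
rewrite mulr_suml ler_sum// => i _; rewrite enormZ mulrC.
by rewrite ler_pM ?enorm_ge0 ?abs_coord_le_enorm//; case: (hM i) => _; exact.
Qed.

Lemma enorm_convex (rho th : R) x v : 0 <= th <= 1 ->
  enorm x <= rho -> enorm (x + v) <= rho -> enorm (x + th *: v) <= rho.
Proof.
move=> /andP[th0 th1] xr xvr.
have -> : x + th *: v = (1 - th) *: x + th *: (x + v).
  by rewrite scalerDr addrA -scalerDl subrK scale1r.
rewrite (le_trans (enormD _ _))// !enormZ !ger0_norm ?subr_ge0//.
rewrite (_ : rho = (1 - th) * rho + th * rho); last by ring.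
by rewrite lerD// ler_wpM2l// subr_ge0.
Qed.

Lemma lipschitz_ball f (rho : R) : differentiable_C1 f ->
  exists2 K : R, 0 <= K & forall x y, enorm x <= rho -> enorm y <= rho ->
    enorm (f x - f y) <= K * enorm (x - y).
Proof.
move=> C1; have [K K0 hK] := derive_bounded _ rho C1.
exists (d%:R * K); first exact: mulr_ge0.
move=> x y xr yr; rewrite (le_trans (enorm_le_sum _))//.
rewrite -mulrA -[X in X%:R]card_ord -sum1_card natr_sum mulr_suml ler_sum// => j _.
have [th th01 E] := MVT_coord f y (x - y) j C1.1.
rewrite [y + _]addrC subrK in E.
rewrite mul1r !mxE E (le_trans (abs_coord_le_enorm _ _))// hK//.
by apply: enorm_convex => //; rewrite addrC subrK.
Qed.

Definition differentiable_C2 f :=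
  (forall x, differentiable f x) /\
  (forall v, differentiable_C1 (fun x => 'D_v f x)).

Lemma differentiable_C2W f : differentiable_C2 f -> differentiable_C1 f.
Proof.
move=> [df C1]; split=> // v x; exact/differentiable_continuous/(C1 v).1.
Qed.

(** The second directional derivatives are continuous by definition if [k = 0], and otherwise
    because they are differentiable. *)
Lemma class_C2 k f : class_C k.+2 f -> differentiable_C2 f.
Proof.
move=> [df h]; split=> // v; have [dv {}h] := h v; split=> // u.
have := h u; case: k {h} => [//|k [+ _]] x; move=> /(_ x).
exact: differentiable_continuous.
Qed.

Lemma derive_lipschitz_ball f (rho : R) : differentiable_C2 f ->
  exists2 K : R, 0 <= K & forall x y v, enorm x <= rho -> enorm y <= rho ->
    enorm ('D_v f x - 'D_v f y) <= K * enorm v * enorm (x - y).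
Proof.
move=> [df C2].
have /choice[M hM] : forall i : 'I_d, exists M : R, 0 <= M /\
    forall x y, enorm x <= rho -> enorm y <= rho ->
    enorm ('D_(delta_mx ord0 i) f x - 'D_(delta_mx ord0 i) f y)
      <= M * enorm (x - y).
  by move=> i; have [M M0 hM] := lipschitz_ball _ rho (C2 (delta_mx ord0 i)); exists M.
exists (\sum_i M i); first by apply: sumr_ge0 => i _; case: (hM i).
move=> x y v xr yr; rewrite !(derive_coordE f)// -sumrB.
rewrite (le_trans (enorm_sum _))// !mulr_suml ler_sum// => i _.
rewrite -scalerBr enormZ mulrAC [leRHS]mulrC.
rewrite ler_pM ?enorm_ge0 ?abs_coord_le_enorm//.
by case: (hM i) => _; exact.
Qed.

(** The mean value theorem writes each coordinate of the increment as a derivative at a point of the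
    segment, and the Lipschitz bound on the derivative gives the second factor [enorm v]. The
    quadratic remainder is what the first variation of the nonlinear functional [J] requires. *)
Lemma taylor_ball f (rho : R) : differentiable_C2 f ->
  exists2 K : R, 0 <= K & forall x v, enorm x <= rho -> enorm (x + v) <= rho ->
    enorm (f (x + v) - f x - 'D_v f x) <= K * enorm v ^+ 2.
Proof.
move=> C2; have [K K0 hK] := derive_lipschitz_ball _ rho C2.
exists (d%:R * K); first exact: mulr_ge0.
move=> x v xr xvr; rewrite (le_trans (enorm_le_sum _))//.
rewrite -mulrA -[X in X%:R]card_ord -sum1_card natr_sum mulr_suml ler_sum// => j _.
have [th th01 E] := MVT_coord f x v j C2.1.
rewrite mul1r.
have -> : (f (x + v) - f x - 'D_v f x) ord0 j =
    ('D_v f (x + th *: v) - 'D_v f x) ord0 j.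
  by rewrite !mxE E.
rewrite (le_trans (abs_coord_le_enorm _ _))//.
rewrite (le_trans (hK _ _ _ _ _))//; first exact: enorm_convex.
rewrite addrAC subrr add0r enormZ expr2 mulrA ler_wpM2l//.
  by rewrite mulr_ge0// enorm_ge0.
by case/andP: th01 => th0 th1; rewrite ger0_norm// ler_piMl// enorm_ge0.
Qed.

(** Enclosing [A] in a ball bounds the set of operator norms, so that [sup_jac f A] is not the
    default value of an unbounded supremum. *)
Lemma derive_le_sup_jac f (A : set 'rV[R]_d) (rho : R) x v :
  differentiable_C1 f -> (forall x, A x -> enorm x <= rho) -> A x ->
  enorm ('D_v f x) <= sup_jac f A * enorm v.
Proof.
move=> C1 Ar Ax; have [K K0 hK] := derive_bounded _ rho C1.
rewrite deriveEjacobian; last exact: C1.1.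
rewrite (le_trans (enorm_mulmx_opnorm _ _))// ler_wpM2r ?enorm_ge0//.
apply: ub_le_sup; last by exists x.
exists K => _ [z Az <-]; apply: opnorm_le => // u.
by rewrite -deriveEjacobian ?hK//; [exact: Ar|exact: C1.1].
Qed.

Lemma is_derive_comp_curve f (y : R -> 'rV[R]_d) (t : R) :
  differentiable f (y t) -> derivable y t 1 ->
  derivable (f \o y) t 1 /\ derive1 (f \o y) t = 'D_(derive1 y t) f (y t).
Proof.
move=> df /derivable1_diffP dy.
have dc : differentiable (f \o y) t by exact: differentiable_comp.
split; first exact/derivable1_diffP.
by rewrite derive1E' // diff_comp //= derive1E' // deriveE.
Qed.

End differentiable_maps.

(** * Absolutely continuous functions *)

Section absolutely_continuous_functions.
Context {R : realType}.
Implicit Types (T : R) (u v H : R -> R).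
Notation mu := (@lebesgue_measure R).

(** Scalar form of [abs_continuous]: the integral calculus is done coordinate by coordinate. *)
Definition acr T u := forall e : R, 0 < e -> exists2 delta : R, 0 < delta &
  forall (n : nat) (a b : 'I_n -> R),
    (forall i, 0 <= a i /\ a i <= b i /\ b i <= T) ->
    trivIset setT (fun i => `]a i, b i[%classic) ->
    \sum_(i < n) (b i - a i) < delta ->
    \sum_(i < n) `|u (b i) - u (a i)| < e.

Lemma acrW T T' u : T' <= T -> acr T u -> acr T' u.
Proof.
move=> TT' ac e /ac[delta d0 h]; exists delta => // n a b ab tab sab.
apply: h => // i; have [? [? /le_trans bT]] := ab i; do 2 split => //.
exact: bT.
Qed.

Lemma acrB T u v : acr T u -> acr T v -> acr T (fun t => u t - v t).
Proof.
move=> acu acv e e0; have e2 : 0 < e / 2 by rewrite divr_gt0.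
have [du du0 hu] := acu _ e2; have [dv dv0 hv] := acv _ e2.
exists (Num.min du dv); first by rewrite lt_min du0.
move=> n a b ab tab; rewrite lt_min => /andP[sdu sdv].
rewrite (splitr e) (le_lt_trans _ (ltrD (hu n a b ab tab sdu)
  (hv n a b ab tab sdv)))//.
rewrite -big_split ler_sum//= => i _.
rewrite (_ : _ - _ = (u (b i) - u (a i)) - (v (b i) - v (a i))); last by ring.
exact: ler_normB.
Qed.

Lemma lebesgue_measure_oo (a b : R) : a <= b -> mu `]a, b[ = (b - a)%:E.
Proof.
move=> ab; rewrite lebesgue_measure_itv/= lte_fin.
move: ab; rewrite le_eqVlt => /predU1P[->|->]; last by rewrite EFinB.
by rewrite ltxx subrr.
Qed.

Lemma lebesgue_measure_oo_lty (a b : R) : (mu `]a, b[ < +oo)%E.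
Proof.
by rewrite lebesgue_measure_itv/=; case: ifP => _; rewrite -?EFinB ltry.
Qed.

Lemma measurable_bounded_integrable_oo (a b M : R) v :
  measurable_fun `]a, b[ v -> {in `]a, b[, forall t, `|v t| <= M} ->
  mu.-integrable `]a, b[ (EFin \o v).
Proof.
move=> mv vM; apply: measurable_bounded_integrable => //.
  exact: lebesgue_measure_oo_lty.
exists M; split; first exact: num_real.
by move=> N /ltW MN t abt; exact: le_trans (vM _ abt) MN.
Qed.

(* Disjoint intervals, listed from right to left. *)
Fixpoint chain (x : R) (s : seq (R * R)) : bool :=
  if s is p :: s' then [&& p.1 <= p.2, p.2 <= x & chain p.1 s'] else 0 <= x.

Lemma chainW x y s : x <= y -> chain x s -> chain y s.
Proof.
case: s => [|p s] xy /=; first by move=> /le_trans; exact.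
by move=> /and3P[-> /le_trans ->].
Qed.

Lemma chain_ge0 x s : chain x s -> 0 <= x.
Proof.
elim: s x => //= p s ih x /and3P[p12 p2x /ih p1].
by rewrite (le_trans p1)// (le_trans p12).
Qed.

Lemma chain_nth x s i : chain x s -> (i < size s)%N ->
  [/\ 0 <= (nth (0, 0) s i).1, (nth (0, 0) s i).1 <= (nth (0, 0) s i).2 &
      (nth (0, 0) s i).2 <= x].
Proof.
elim: s x i => //= p s ih x [|i] /and3P[p12 p2x ch] /=.
  by move=> _; split=> //; exact: chain_ge0 ch.
rewrite ltnS => /(ih _ _ ch)[? ? h]; split=> //.
by rewrite (le_trans h)// (le_trans p12).
Qed.

Lemma chain_nth_lt x s i j : chain x s -> (i < j)%N -> (j < size s)%N ->
  (nth (0, 0) s j).2 <= (nth (0, 0) s i).1.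
Proof.
elim: s x i j => //= p s ih x [|i] [|j] // /and3P[p12 p2x ch] /=.
  by move=> _; rewrite ltnS => /(chain_nth _ _ _ ch)[].
by rewrite ltnS => ij js; exact: ih ch ij js.
Qed.

(** A chain grows by one interval with a single cons, which suits the left-to-right sweep of
    [acr_derive0_eq] better than families indexed by ['I_n]. *)
Lemma acr_chain T u : acr T u -> forall e : R, 0 < e ->
  exists2 delta : R, 0 < delta & forall s, chain T s ->
    \sum_(p <- s) (p.2 - p.1) < delta ->
    \sum_(p <- s) `|u p.2 - u p.1| < e.
Proof.
move=> ac e /ac[delta d0 h]; exists delta => // s ch.
rewrite !(big_nth (0, 0)) !big_mkord.
apply: (h (size s) (fun i => (nth (0, 0) s i).1) (fun i => (nth (0, 0) s i).2)).
  by move=> i; have [] := chain_nth _ _ _ ch (ltn_ord i).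
have dj (i j : 'I_(size s)) : (i < j)%N ->
    `](nth (0, 0) s i).1, (nth (0, 0) s i).2[%classic `&`
    `](nth (0, 0) s j).1, (nth (0, 0) s j).2[%classic = set0.
  move=> ij; rewrite -subset0 => z [] /=; rewrite !in_itv/=.
  move=> /andP[iz _] /andP[_ zj].
  have := chain_nth_lt _ _ _ _ ch ij (ltn_ord j).
  by rewrite leNgt (lt_trans iz zj).
apply/trivIsetP => i j _ _ ij.
case: (ltngtP i j) => ij'; first exact: dj.
  by rewrite setIC dj.
by move: ij; rewrite (val_inj ij') eqxx.
Qed.

(** Cutting [O] at [x] makes the induction work: the head interval is disjoint from the part of [O]
    to the left of its own left endpoint. *)
Lemma chain_measure (O : set R) x s : measurable O -> chain x s ->
  (forall p, p \in s -> `]p.1, p.2[ `<=` O) ->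
  ((\sum_(p <- s) (p.2 - p.1))%:E <= mu (O `&` `]-oo, x[))%E.
Proof.
move=> mO; elim: s x => [|p s ih] x /=; first by rewrite big_nil.
move=> /and3P[p12 p2x ch] hs; rewrite big_cons.
have h1 := ih _ ch (fun q qs => hs q (mem_behead (s:=p::s) qs)).
have mA : measurable (O `&` `]-oo, p.1[ : set R) by exact: measurableI.
have sub : (`]p.1, p.2[ `|` (O `&` `]-oo, p.1[)) `<=` O `&` `]-oo, x[.
  move=> z [zp|[Oz]].
    split; first by apply: (hs p); rewrite ?mem_head.
    by move: zp; rewrite /= !in_itv/= => /andP[_ /lt_le_trans]; exact.
  rewrite /= !in_itv/= => zp1; split => //=.
  by rewrite (lt_le_trans zp1)// (le_trans p12).
apply: (le_trans _ (le_measure mu _ _ sub)); rewrite ?inE; last 2 first.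
- exact: measurableU.
- exact: measurableI.
rewrite measureU//; last first.
  rewrite -subset0 => z [] /=; rewrite !in_itv/= => /andP[+ _] [_].
  by move=> /lt_trans h /h; rewrite ltxx.
rewrite EFinD leeD//; apply: (@le_trans _ _ (mu `]p.1, p.2[)); last exact: le_refl.
by rewrite lebesgue_measure_oo.
Qed.

Lemma derive0_local H (c e : R) : is_derive c 1 H 0 -> 0 < e ->
  exists2 eta : R, 0 < eta & forall y, `|y - c| < eta ->
    `|H y - H c| <= e * `|y - c|.
Proof.
move=> [dH dH0] e0.
move: (dH) => /cvg_ex[/= l hl].
have l0 : l = 0 by rewrite -[RHS]dH0; apply/esym/cvg_lim.
move: hl; rewrite l0 => /cvgrPdist_le/(_ _ e0)[/= eta eta0 h].
exists eta => // y yc.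
have [->|ync] := eqVneq y c; first by rewrite !subrr normr0 mulr0.
have := h (y - c).
rewrite /ball_/= !sub0r !normrN => /(_ yc); rewrite subr_eq0 => /(_ ync).
rewrite [_ *: 1]mulr1 subrK normrM normfV mulrC ler_pdivrMr//.
by rewrite normr_gt0 subr_eq0.
Qed.

(* The exceptional null set is enclosed in a small open set [O]. Moving to the
   right from [0], the increments of [H] are controlled by [H' = 0] at the points
   outside [O] and by absolute continuity on the intervals contained in [O]. *)
Lemma acr_derive0_eq T H : 0 < T -> acr T H ->
  {ae mu, forall t, t \in `]0, T[ -> is_derive t 1 H 0} -> H T = H 0.
Proof.
move=> T0 acH [N [mN N0 hN]].
suff h (e : R) : 0 < e -> `|H T - H 0| <= e * T + e.
  apply/eqP; rewrite -subr_eq0 -normr_le0; apply/ler_addgt0Pl => e e0.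
  rewrite addr0; have T1 : 0 < T + 1 by rewrite addr_gt0.
  have := h (e / (T + 1)) (divr_gt0 e0 T1).
  by rewrite -{2}(mulr1 (e / _)) -mulrDr divfK// gt_eqF.
move=> e0; have [delta d0 hd] := acr_chain _ _ acH _ e0.
(* The endpoints join the exceptional set, since the hypothesis on the derivative covers interior
   points only. *)
pose D := N `|` ([set 0] `|` [set T]).
have mD : measurable D by apply: measurableU => //; exact: measurableU.
have D0 : mu D = 0%E.
  have z1 (x : R) : mu [set x] = 0%E by exact: lebesgue_measure_set1.
  rewrite measureU0//; first exact: measurableU.
  by rewrite measureU0//; exact: z1.
have [|O [oO DO OD]] := @lebesgue_regularity_outer R D delta mD _ d0.
  apply: (@le_lt_trans _ _ (mu D)); first exact: le_refl.
  by rewrite D0 ltry.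
have mO : measurable O by exact: open_measurable.
have Odelta : (mu O < delta%:E)%E.
  apply: (@le_lt_trans _ _ (mu D + mu (O `\` D))%E).
    rewrite -{1}(setDUK DO); apply: measureU2 => //; exact: measurableD.
  by rewrite D0 add0e.
(* The invariant of the sweep: up to [x], the increment of [H] costs [e] per unit length, plus the
   variation over a chain inside [O]. The final chain has total length below [delta], so that this
   variation is below [e]. *)
pose P x := exists s, [/\ chain x s, forall p, p \in s -> `]p.1, p.2[ `<=` O &
  `|H x - H 0| <= e * x + \sum_(p <- s) `|H p.2 - H p.1|].
have P0 : P 0.
  by exists [::]; split => //=; rewrite big_nil subrr normr0 mulr0 addr0.
have PO x y : x <= y -> `]x, y[ `<=` O -> P x -> P y.
  move=> xy xyO [s [ch sO hx]]; exists ((x, y) :: s); split => /=.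
  - by rewrite xy lexx.
  - by move=> p; rewrite inE => /predU1P[->//|]; exact: sO.
  rewrite big_cons /= (le_trans (ler_distD (H x) _ _))// addrCA lerD//.
  by rewrite (le_trans hx)// lerD2r ler_wpM2l// ltW.
have Pd x y : x <= y -> `|H y - H x| <= e * (y - x) -> P x -> P y.
  move=> xy hxy [s [ch sO hx]]; exists s; split => //; first exact: chainW ch.
  rewrite (le_trans (ler_distD (H x) _ _))// (le_trans (lerD hxy hx))//.
  by rewrite addrA -mulrDr subrK.
(* Each [c] has a neighbourhood across which [P] propagates to the right: inside [O] the chain
   receives one more interval, and outside [O] the zero derivative at [c] pays for the step. *)
have gauge c : 0 <= c <= T -> exists2 eta : R, 0 < eta &
    forall x y, x <= c <= y -> c - eta < x -> y < c + eta -> P x -> P y.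
  move=> cT; have [cO|cO] := pselect (O c).
    have [eta /= eta0 hO] := (@nbhs_ballP _ _ c O).1 (open_nbhs_nbhs (conj oO cO)).
    exists eta => // x y /andP[xc cy] cx yc; apply: PO.
      exact: le_trans xc cy.
    move=> z /=; rewrite in_itv/= => /andP[xz zy]; apply: hO.
    rewrite /ball/= distrC ltr_distl.
    by rewrite (lt_trans cx xz) (lt_trans zy yc).
  have dc : is_derive c 1 H 0.
    apply: contrapT => ndc; apply/cO/DO; left; apply: hN => /= h.
    apply/ndc/h; rewrite in_itv/=.
    case/andP: cT => c0 cT; rewrite !lt_neqAle c0 cT !andbT.
    apply/andP; split; apply/eqP => ?; apply/cO/DO; right.
      by left => /=.
    by right => /=.
  have [eta eta0 heta] := derive0_local _ _ _ dc e0.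
  exists eta => // x y /andP[xc cy] cx yc; apply: Pd.
    exact: le_trans xc cy.
  rewrite (le_trans (ler_distD (H c) _ _))//.
  rewrite (_ : y - x = `|y - c| + `|x - c|); last first.
    by rewrite ger0_norm ?subr_ge0// distrC ger0_norm ?subr_ge0//; ring.
  rewrite mulrDr lerD//.
    by apply: heta; rewrite ger0_norm ?subr_ge0// ltrBlDl.
  rewrite distrC heta// distrC ger0_norm ?subr_ge0//.
  by rewrite ltrBlDr -ltrBlDl.
(* Continuous induction: the gauge at [c = sup S] carries [P] from a point of [S] close to [c] to a
   point beyond [c], unless [T] is reached. *)
pose S := [set x | 0 <= x <= T /\ P x].
have S0 : S 0 by split; rewrite ?lexx ?ltW.
have uS : has_ubound S by exists T => x [/andP[]].
have supS : has_sup S by split => //; exists 0.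
pose c := sup S.
have c0 : 0 <= c by apply: ub_le_sup.
have cT : c <= T by apply: ge_sup; [exists 0|move=> x [/andP[]]].
have [|eta eta0 heta] := gauge c; first by rewrite c0.
have [x [/andP[x0 xT] Px] cx] := sup_adherent eta0 supS.
have xc : x <= c by apply: ub_le_sup => //; split => //; rewrite x0.
pose y := Num.min T (c + eta / 2).
have cy : c <= y by rewrite le_min cT lerDl divr_ge0// ltW.
have Py : P y.
  apply: (heta x) => //; first by rewrite xc.
  rewrite gt_min; apply/orP; right.
  by rewrite ltrD2l ltr_pdivrMr// ltr_pMr// ltr1n.
have yT : y = T.
  have : y <= c.
    apply: ub_le_sup => //; split => //.
    by rewrite (le_trans c0 cy) ge_min lexx.
  rewrite ge_min => /orP[Tc|].
    by apply/eqP; rewrite eq_le ge_min lexx/= (le_trans Tc).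
  by rewrite -lerBrDl subrr leNgt divr_gt0.
move: Py; rewrite yT => -[s [ch sO hT]].
rewrite (le_trans hT)// lerD2l ltW// hd//.
rewrite -lte_fin (le_lt_trans _ Odelta)//.
rewrite (le_trans (chain_measure _ _ _ mO ch sO))//.
by rewrite le_measure ?inE//; exact: measurableI.
Qed.

(** On an interval of finite measure, [|v| <= 1 + v^2] gives integrability of [v]. *)
Lemma integrable_of_sqr T v : measurable_fun `]0, T[ v ->
  (\int[mu]_(t in `]0%R, T[) (v t ^+ 2)%:E < +oo)%E ->
  mu.-integrable `]0, T[ (EFin \o v) /\
  mu.-integrable `]0, T[ (EFin \o (fun t => v t ^+ 2)).
Proof.
move=> mv vfin.
have mv2 : measurable_fun `]0, T[ (fun t => v t ^+ 2).
  exact: measurable_funX.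
have i2 : mu.-integrable `]0, T[ (EFin \o (fun t => v t ^+ 2)).
  apply/integrableP; split; first exact/measurable_EFinP.
  under eq_integral do rewrite /= ger0_norm ?sqr_ge0//.
  exact: vfin.
split=> //.
have i1 : mu.-integrable `]0, T[ (EFin \o (cst 1 : R -> R)).
  by apply: (@measurable_bounded_integrable_oo _ _ 1) => // t _; rewrite normr1.
apply: (le_integrable _ _ _ (integrableD _ i1 i2)) => //.
  exact/measurable_EFinP.
move=> t _ /=; rewrite lee_fin [leRHS]ger0_norm ?addr_ge0 ?sqr_ge0//.
have := sqr_ge0 (`|v t| - 2^-1); rewrite sqrrB -[v t ^+ 2]real_normK ?num_real//.
by rewrite -mulr_natl; nra.
Qed.


Lemma integrable_subset_oo (T a b : R) v : 0 <= a -> b <= T ->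
  mu.-integrable `]0, T[ (EFin \o v) -> mu.-integrable `]a, b[ (EFin \o v).
Proof.
move=> a0 bT; apply: integrableS => //.
move=> t /=; rewrite !in_itv/= => /andP[at_ tb].
by rewrite (le_lt_trans a0 at_) (lt_le_trans tb bT).
Qed.

(* [|v| <= l v^2 + 1/l]; the parameter [l] makes the absolute continuity of the
   integral of a square integrable function immediate. *)
Lemma abs_Rintegral_le (T a b l : R) v : 0 <= a -> a <= b -> b <= T -> 0 < l ->
  mu.-integrable `]0, T[ (EFin \o v) ->
  mu.-integrable `]0, T[ (EFin \o (fun t => v t ^+ 2)) ->
  `|\int[mu]_(t in `]a, b[) v t| <=
    l * (\int[mu]_(t in `]a, b[) v t ^+ 2) + l^-1 * (b - a).
Proof.
move=> a0 ab bT l0 /(integrable_subset_oo _ a b _ a0 bT) i1.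
move=> /(integrable_subset_oo _ a b _ a0 bT) i2.
have ic : mu.-integrable `]a, b[ (EFin \o (cst (l^-1) : R -> R)).
  by apply: (@measurable_bounded_integrable_oo _ _ `|l^-1|).
have il2 : mu.-integrable `]a, b[ (EFin \o (fun t => l * v t ^+ 2)).
  exact: (integrableZl _ l i2).
rewrite (le_trans (le_normr_Rintegral _ _))//.
apply: (@le_trans _ _ (\int[mu]_(t in `]a, b[) (l * v t ^+ 2 + l^-1))).
  apply: le_Rintegral => //.
  - exact: integrable_norm.
  - exact: (integrableD _ il2 ic).
  move=> t _; rewrite -[v t ^+ 2]real_normK ?num_real//.
  rewrite -(ler_pM2l l0) mulrDr divff ?gt_eqF//.
  rewrite (_ : l * (l * _) = (l * `|v t|) ^+ 2); last by ring.
  have : 0 <= l * `|v t| by rewrite mulr_ge0// ltW.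
  by have := sqr_ge0 (l * `|v t| - 1); set p := l * _; nra.
rewrite RintegralD// RintegralZl// lerD2l Rintegral_cst//.
apply: (@le_trans _ _ (l^-1 * fine (mu `]a, b[))); first exact: le_refl.
by rewrite lebesgue_measure_oo.
Qed.

Lemma acr_Rintegral T v (V : R -> R) :
  mu.-integrable `]0, T[ (EFin \o v) ->
  mu.-integrable `]0, T[ (EFin \o (fun t => v t ^+ 2)) ->
  (forall a b, 0 <= a -> a <= b -> b <= T ->
    V b - V a = \int[mu]_(t in `]a, b[) v t) ->
  acr T V.
Proof.
move=> i1 i2 hV e e0.
pose Q := \int[mu]_(t in `]0, T[) v t ^+ 2.
have Q0 : 0 <= Q by apply: Rintegral_ge0 => t _; exact: sqr_ge0.
(* With this [l] the squares contribute at most [l * (Q + 1) = e / 2], and [delta = l * (e / 2)]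
   keeps the lengths, which are weighted by [l^-1], below [e / 2]. *)
pose l := e / (2 * (Q + 1)).
have l0 : 0 < l by rewrite divr_gt0// mulr_gt0// ltr_wpDl.
exists (l * (e / 2)); first by rewrite mulr_gt0// divr_gt0.
move=> n a b hab tab hs.
apply: (@le_lt_trans _ _ (\sum_(i < n)
    (l * (\int[mu]_(t in `]a i, b i[) v t ^+ 2) + l^-1 * (b i - a i)))).
  apply: ler_sum => i _; have [ai [abi bi]] := hab i; rewrite hV//.
  exact: abs_Rintegral_le i1 i2.
rewrite big_split/= -!mulr_sumr (splitr e) ler_ltD//; last first.
  by rewrite -(ltr_pM2l l0) mulrA divff ?gt_eqF// mul1r.
(* The intervals are disjoint, so the sum is one integral over their union, a subset of []0, T[]. *)
suff SQ : \sum_(i < n) \int[mu]_(t in `]a i, b i[) v t ^+ 2 <= Q.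
  apply: (@le_trans _ _ (l * (Q + 1))).
    by rewrite ler_pM2l//; apply: (le_trans SQ); rewrite lerDl.
  have Q1 : Q + 1 != 0 by rewrite gt_eqF// ltr_wpDl.
  by rewrite (_ : l * (Q + 1) = e / 2)// /l; field.
pose F i := `]a i, b i[%classic : set R.
have FD i : F i `<=` `]0, T[.
  move=> t; rewrite /F /= !in_itv/=; have [a0 [_ bT]] := hab i.
  by move=> /andP[at_ tb]; rewrite (le_lt_trans a0 at_) (lt_le_trans tb bT).
have UD : \big[setU/set0]_(i < n) F i `<=` `]0, T[.
  elim/big_ind: _ => [|A B AD BD|i _]; [exact: sub0set| |exact: FD].
  by rewrite subUset.
have ifin A : measurable A -> A `<=` `]0, T[ ->
    (\int[mu]_(t in A) (v t ^+ 2)%:E)%E \is a fin_num.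
  by move=> mA AD; apply: integrable_fin_num => //; apply: integrableS i2.
have mU : measurable (\big[setU/set0]_(i < n) F i).
  by apply: bigsetU_measurable => i _; exact: measurable_itv.
rewrite -lee_fin /Q -sumEFin /Rintegral fineK; last exact: ifin.
rewrite (eq_bigr (fun i => \int[mu]_(t in F i) (v t ^+ 2)%:E)%E); last first.
  by move=> i _; rewrite fineK//; apply: ifin; [exact: measurable_itv|exact: FD].
have mv2 : measurable_fun `]0, T[ (fun t => (v t ^+ 2)%:E).
  exact: measurable_int i2.
rewrite -(ge0_integral_bigsetU _ _ (index_enum_uniq 'I_n)) //=.
- apply: ge0_subset_integral => //.
  by move=> t _; rewrite lee_fin sqr_ge0.
- by move=> i; exact: measurable_itv.
- exact: sub_trivIset tab.
- exact: measurable_funS mv2.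
- by move=> t _; rewrite lee_fin sqr_ge0.
Qed.

(** By Lebesgue differentiation the primitive [V] of [v] has derivative [v] almost everywhere, and
    [V] is absolutely continuous because [v] is square integrable. Hence [u - V] has zero derivative
    almost everywhere, and [acr_derive0_eq] on each [[0, c]] makes it constant. Extending [v] by
    zero lets the primitive start at minus infinity. *)
Lemma acr_FTC T u v : 0 < T -> acr T u ->
  measurable_fun `]0, T[ v ->
  (\int[mu]_(t in `]0%R, T[) (v t ^+ 2)%:E < +oo)%E ->
  {ae mu, forall t, t \in `]0, T[ -> is_derive t 1 u (v t)} ->
  forall a b, 0 <= a -> a <= b -> b <= T ->
  u b - u a = \int[mu]_(t in `]a, b[) v t.
Proof.
move=> T0 acu mv vfin du.
have [i1 i2] := integrable_of_sqr _ _ mv vfin.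
pose vT := v \_ `]0, T[.
have ivT A : measurable A -> mu.-integrable A (EFin \o vT).
  move=> mA; rewrite (_ : EFin \o vT = (EFin \o v) \_ `]0, T[); last first.
    by rewrite /vT restrict_EFin.
  apply: (@integrableS _ _ _ _ setT) => //.
  by rewrite -integrable_mkcond.
pose V x := \int[mu]_(t in `]-oo, x]) vT t.
have hV a b : 0 <= a -> a <= b -> b <= T ->
    V b - V a = \int[mu]_(t in `]a, b[) v t.
  move=> a0 ab bT; rewrite /V Rintegral_itvB//; last exact: ivT.
  rewrite -Rintegral_itv_bndo_bndc; last exact: ivT.
  apply: eq_Rintegral => t; rewrite inE/= in_itv/= => /andP[at_ tb].
  rewrite /vT patchE mem_set//= in_itv/=.
  by rewrite (le_lt_trans a0 at_) (lt_le_trans tb bT).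
have acV : acr T V by exact: acr_Rintegral i1 i2 hV.
have dV : {ae mu, forall x, derivable V x 1 /\ derive1 V x = vT x}.
  apply: FTC1Ny => [y|]; first exact: ivT.
  exact: integrable_locally_restrict.
suff h c : 0 <= c -> c <= T -> u c - V c = u 0 - V 0.
  move=> a b a0 ab bT; rewrite -hV//.
  have ha := h a a0 (le_trans ab bT); have hb := h b (le_trans a0 ab) bT.
  lra.
rewrite le_eqVlt => /predU1P[<-//|c0] cT.
apply: (@acr_derive0_eq c (fun t => u t - V t)) => //.
  exact: acrW cT (acrB _ _ _ acu acV).
have aeF := ae_filter_ringOfSetsType mu.
apply: (@filterS2 _ _ aeF _ _ _ _ du dV) => t dut [dV1 dV2] tc.
have tT : t \in `]0, T[.
  by move: tc; rewrite !in_itv/= => /andP[-> /lt_le_trans]; exact.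
have isV : is_derive t 1 V (v t).
  by split => //; rewrite -derive1E dV2 /vT patchE mem_set.
by have := is_deriveB (dut tT) isV; rewrite subrr.
Qed.

End absolutely_continuous_functions.

(** * Integrals of functions not known to be measurable *)

Section nonmeasurable_integrand.
Import HBNNSimple.
Local Open Scope ereal_scope.

(* The integrand [f] need not be measurable: its integral is then a supremum
   over the simple functions below it, which is insensitive to null sets. *)
Lemma ge0_integral_setD_null d (X : measurableType d) (R : realType)
    (mu : {measure set X -> \bar R}) (D N : set X) (f : X -> \bar R) :
  measurable N -> mu N = 0 -> (forall x, D x -> 0 <= f x) ->
  \int[mu]_(x in D) f x = \int[mu]_(x in D `\` N) f x.
Proof.
move=> mN N0 f0.
have f0' x : (D `\` N) x -> 0 <= f x by move=> [Dx _]; exact: f0.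
rewrite !ge0_integralE//; apply/eqP; rewrite eq_le; apply/andP; split.
  apply: ge_ereal_sup => /= _ [h /= hf <-].
  have mCN : measurable (~` N) by exact: measurableC.
  (* Cutting [h] off on the null set [N] preserves its integral and brings it below [f] on [D] minus
     [N]. The converse inequality further down uses that [f] is nonnegative on [D]. *)
  have -> : sintegral mu h = sintegral mu (proj_nnsfun h mCN).
    rewrite -!integralT_nnsfun (ge0_negligible_integral mN)//; last 2 first.
    - exact/measurable_EFinP.
    - by move=> x _; rewrite lee_fin.
    rewrite setTD integral_mkcond; apply: eq_integral => x _.
    by rewrite restrict_EFin -mrestrict.
  apply: ereal_sup_ubound; exists (proj_nnsfun h mCN) => [x|//].
  have -> : proj_nnsfun h mCN x = (h \_ (~` N)) x by rewrite -mrestrict.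
  have := hf x; rewrite !patchE in_setC in_setD; have [xN _|xN] := boolP (x \in N).
    by rewrite andbF.
  by rewrite andbT.
apply: ge_ereal_sup => /= _ [h /= hf <-].
apply: ereal_sup_ubound; exists h => //= x.
rewrite (le_trans (hf x))// !patchE in_setD; case: (boolP (x \in D)) => //= xD.
by case: ifP => // _; apply/f0/set_mem.
Qed.

(** Measurability is assumed of [g] alone: in the applications [f] involves [derive1] of a sum or
    difference, which is known only off a null set. *)
Lemma ge0_integral_eq_off_null d (X : measurableType d) (R : realType)
    (mu : {measure set X -> \bar R}) (D N : set X) (f g : X -> \bar R) :
  measurable D -> measurable N -> mu N = 0 -> measurable_fun D g ->
  (forall x, D x -> 0 <= f x) -> (forall x, D x -> 0 <= g x) ->
  (forall x, D x -> ~ N x -> f x = g x) ->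
  \int[mu]_(x in D) f x = \int[mu]_(x in D) g x.
Proof.
move=> mD mN N0 mg f0 g0 fg.
rewrite (ge0_integral_setD_null _ _ _ _ _ N)//.
rewrite [RHS](ge0_integral_setD_null _ _ _ _ _ N)//.
by apply: eq_integral => x /set_mem[Dx Nx]; exact: fg.
Qed.

End nonmeasurable_integrand.

(** * Cauchy-Schwarz for integrals *)

Section integral_inequalities.
Context {R : realType}.
Notation mu := (@lebesgue_measure R).

Lemma Rintegral_cauchy_schwarz (D : set R) (f g : R -> R) : measurable D ->
  mu.-integrable D (EFin \o (fun t => f t ^+ 2)) ->
  mu.-integrable D (EFin \o (fun t => g t ^+ 2)) ->
  mu.-integrable D (EFin \o (fun t => f t * g t)) ->
  `|\int[mu]_(t in D) (f t * g t)| <=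
  Num.sqrt (\int[mu]_(t in D) f t ^+ 2) * Num.sqrt (\int[mu]_(t in D) g t ^+ 2).
Proof.
move=> mD if2 ig2 ifg; apply: discriminant_le.
- by apply: Rintegral_ge0 => t _; exact: sqr_ge0.
- by apply: Rintegral_ge0 => t _; exact: sqr_ge0.
move=> l.
have i1 : mu.-integrable D (EFin \o (fun t => (l *+ 2) * (f t * g t))).
  exact: (integrableZl _ (l *+ 2) ifg).
have i2 : mu.-integrable D (EFin \o (fun t => l ^+ 2 * g t ^+ 2)).
  exact: (integrableZl _ (l ^+ 2) ig2).
rewrite -mulrnAl -!RintegralZl// -!RintegralD//; last exact: (integrableD _ if2 i1).
apply: Rintegral_ge0 => t _.
rewrite (_ : _ + _ = (f t + l * g t) ^+ 2) ?sqr_ge0//; ring.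
Qed.

(** Pair [v] with the constant 1. *)
Lemma Rintegral_cauchy_schwarz_oo (T a b : R) v :
  0 <= a -> a <= b -> b <= T ->
  mu.-integrable `]0, T[ (EFin \o v) ->
  mu.-integrable `]0, T[ (EFin \o (fun t => v t ^+ 2)) ->
  `|\int[mu]_(t in `]a, b[) v t| <=
    Num.sqrt (b - a) * Num.sqrt (\int[mu]_(t in `]a, b[) v t ^+ 2).
Proof.
move=> a0 ab bT /(integrable_subset_oo _ a b _ a0 bT) i1.
move=> /(integrable_subset_oo _ a b _ a0 bT) i2.
have E1 : \int[mu]_(t in `]a, b[) (1 * v t) = \int[mu]_(t in `]a, b[) v t.
  by apply: eq_Rintegral => t _; rewrite mul1r.
have E2 : \int[mu]_(t in `]a, b[) (1 ^+ 2) = b - a.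
  rewrite Rintegral_cst// expr1n mul1r.
  apply: (@eq_trans _ _ (fine (mu `]a, b[))); first by [].
  by rewrite lebesgue_measure_oo.
rewrite -E1 -E2; apply: Rintegral_cauchy_schwarz => //.
  apply: (@measurable_bounded_integrable_oo _ _ _ 1) => // t _.
  by rewrite expr1n normr1.
rewrite (_ : (fun t => 1 * v t) = v)//.
by apply/funext => t; rewrite mul1r.
Qed.

End integral_inequalities.

(** * The space H^1 *)

Section sobolev.
Context {R : realType} {d : nat}.
Implicit Types (T : R) (u v : R -> 'rV[R]_d).
Notation mu := (@lebesgue_measure R).

Definition coord_measurable T u :=
  forall i, measurable_fun `]0, T[ (fun t => u t ord0 i).

Lemma measurable_dot T u v : coord_measurable T u -> coord_measurable T v ->
  measurable_fun `]0, T[ (fun t => dot (u t) (v t)).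
Proof.
by move=> mu_ mv; apply: measurable_sum => i; exact: measurable_funM.
Qed.

Lemma measurable_sqr_enorm T u : coord_measurable T u ->
  measurable_fun `]0, T[ (fun t => enorm (u t) ^+ 2).
Proof.
move=> mu_; rewrite (_ : (fun t => _) = (fun t => dot (u t) (u t))).
  exact: measurable_dot.
by apply/funext => t; rewrite sqr_enorm.
Qed.

Lemma measurable_enorm T u : coord_measurable T u ->
  measurable_fun `]0, T[ (fun t => enorm (u t)).
Proof.
move=> mu_; apply: measurableT_comp; last exact: measurable_dot.
by apply: continuous_measurable_fun; exact: sqrt_continuous.
Qed.

Lemma in_L2_integrable T u : in_L2 T u ->
  mu.-integrable `]0, T[ (EFin \o (fun t => enorm (u t))) /\
  mu.-integrable `]0, T[ (EFin \o (fun t => enorm (u t) ^+ 2)).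
Proof.
by move=> [mu_ fu]; apply: integrable_of_sqr => //; exact: measurable_enorm.
Qed.

Lemma in_L2_coord T u i : in_L2 T u ->
  (\int[mu]_(t in `]0%R, T[) ((u t ord0 i) ^+ 2)%:E < +oo)%E.
Proof.
move=> [mu_ fu]; apply: le_lt_trans fu; apply: ge0_le_integral => //.
- by move=> t _; rewrite lee_fin sqr_ge0.
- by apply/measurable_EFinP/measurable_funX; exact: mu_.
- by apply/measurable_EFinP; exact: measurable_sqr_enorm mu_.
- move=> t _; rewrite lee_fin -[leLHS]real_normK ?num_real//.
  by rewrite ler_pXn2r ?nnegrE ?enorm_ge0// abs_coord_le_enorm.
Qed.

Lemma in_L2_coord_integrable T u i : in_L2 T u ->
  mu.-integrable `]0, T[ (EFin \o (fun t => u t ord0 i)) /\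
  mu.-integrable `]0, T[ (EFin \o (fun t => (u t ord0 i) ^+ 2)).
Proof.
move=> Lu; apply: integrable_of_sqr; first exact: Lu.1.
exact: in_L2_coord.
Qed.

Lemma is_derive_coord u (t : R) i : derivable u t 1 ->
  is_derive t 1 (fun t => u t ord0 i) (derive1 u t ord0 i).
Proof.
move=> du; split; first exact: (derivable_mxP _ _ _).1.
by rewrite derive1E derive_mx// mxE.
Qed.

Lemma acr_coord T u i : abs_continuous T u -> acr T (fun t => u t ord0 i).
Proof.
move=> ac e /ac[delta d0 h]; exists delta => // n a b ab tab sab.
apply: le_lt_trans (h n a b ab tab sab); apply: ler_sum => k _.
have -> : u (b k) ord0 i - u (a k) ord0 i = (u (b k) - u (a k)) ord0 i.
  by rewrite !mxE.
exact: abs_coord_le_enorm.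
Qed.

Lemma in_H1_FTC T u i a b : 0 < T -> in_H1 T u ->
  0 <= a -> a <= b -> b <= T ->
  u b ord0 i - u a ord0 i = \int[mu]_(t in `]a, b[) (derive1 u t ord0 i).
Proof.
move=> T0 [acu du Lu]; apply: (@acr_FTC _ _ (fun t => u t ord0 i)) => //.
- exact: acr_coord.
- exact: Lu.1.
- exact: in_L2_coord.
have aeF := ae_filter_ringOfSetsType mu.
by apply: (@filterS _ _ aeF _ _ _ du) => t h /h; exact: is_derive_coord.
Qed.

Lemma dot_X_norm T u :
  dot_X T u u = \int[mu]_(t in `]0, T[) enorm (derive1 u t) ^+ 2 + enorm (u 0) ^+ 2.
Proof. by rewrite sqr_enorm; under eq_Rintegral do rewrite sqr_enorm. Qed.

Lemma dot_X_ge0 T u : 0 <= dot_X T u u.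
Proof.
by rewrite dot_X_norm addr_ge0 ?sqr_ge0// Rintegral_ge0// => t _; exact: sqr_ge0.
Qed.

Lemma norm_X_ge0 T u : 0 <= norm_X T u.
Proof. exact: sqrtr_ge0. Qed.

Lemma sqr_norm_X T u : norm_X T u ^+ 2 =
  \int[mu]_(t in `]0, T[) enorm (derive1 u t) ^+ 2 + enorm (u 0) ^+ 2.
Proof. by rewrite /norm_X sqr_sqrtr ?dot_X_ge0// dot_X_norm. Qed.

Lemma sqr_norm_L2 T u : norm_L2 T u ^+ 2 =
  \int[mu]_(t in `]0, T[) enorm (u t) ^+ 2.
Proof.
by rewrite /norm_L2 sqr_sqrtr// Rintegral_ge0// => t _; exact: sqr_ge0.
Qed.

Lemma norm_L2_derive1_le T u : norm_L2 T (derive1 u) <= norm_X T u.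
Proof.
rewrite -(@ler_pXn2r _ 2)// ?nnegrE ?sqrtr_ge0//.
by rewrite sqr_norm_L2 sqr_norm_X lerDl sqr_ge0.
Qed.

Lemma enorm_0_le T u : enorm (u 0) <= norm_X T u.
Proof.
rewrite -(@ler_pXn2r _ 2)// ?nnegrE ?sqrtr_ge0//.
rewrite sqr_norm_X lerDr Rintegral_ge0// => t _; exact: sqr_ge0.
Qed.

Lemma Rintegral_sqr_coord_le T v i a' b' a b : in_L2 T v ->
  0 <= a' -> a' <= a -> b <= b' -> b' <= T ->
  \int[mu]_(t in `]a, b[) (v t ord0 i) ^+ 2 <=
  \int[mu]_(t in `]a', b'[) enorm (v t) ^+ 2.
Proof.
move=> Lv a'0 a'a bb' b'T.
have a0 := le_trans a'0 a'a; have bT := le_trans bb' b'T.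
have [_ i2] := in_L2_coord_integrable _ _ i Lv.
have [_ i3] := in_L2_integrable _ _ Lv.
have i3' := integrable_subset_oo T a' b' _ a'0 b'T i3.
have i3'' := integrable_subset_oo T a b _ a0 bT i3.
apply: (@le_trans _ _ (\int[mu]_(t in `]a, b[) enorm (v t) ^+ 2)).
  apply: le_Rintegral => //; first exact: integrable_subset_oo i2.
  move=> x _; rewrite -[leLHS]real_normK ?num_real//.
  by rewrite ler_pXn2r ?nnegrE ?enorm_ge0// abs_coord_le_enorm.
rewrite /Rintegral fine_le//; [exact: integrable_fin_num..|].
apply: ge0_subset_integral => //.
- exact: measurable_int i3'.
- by move=> x _; rewrite lee_fin sqr_ge0.
move=> x /=; rewrite !in_itv/= => /andP[ax xb].
by rewrite (le_lt_trans a'a ax) (lt_le_trans xb bb').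
Qed.

(** The explicit constant is not meant to be sharp. It shows that the set defining [const_max] is
    nonempty, so that its infimum is meaningful; [norm_L2_embedding] does the same for
    [const_L2]. *)
Lemma sobolev_embedding T u t : 0 < T -> in_H1 T u -> t \in `[0, T] ->
  enorm (u t) <= d%:R * (1 + Num.sqrt T) * norm_X T u.
Proof.
move=> T0 Hu; rewrite in_itv/= => /andP[t0 tT].
rewrite (le_trans (enorm_le_sum _))//.
rewrite -mulrA -[X in X%:R]card_ord -sum1_card natr_sum mulr_suml ler_sum// => i _.
rewrite mul1r mulrDl mul1r -(subrK (u 0 ord0 i) (u t ord0 i)).
rewrite (le_trans (ler_normD _ _))// addrC lerD//.
  by rewrite (le_trans (abs_coord_le_enorm _ _))// enorm_0_le.
have [_ _ Lu] := Hu.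
have [i1 i2] := in_L2_coord_integrable _ _ i Lu.
rewrite (in_H1_FTC T)//.
rewrite (le_trans (Rintegral_cauchy_schwarz_oo T _ _ _ _ _ _ i1 i2))// subr0.
rewrite ler_pM ?sqrtr_ge0//; first by rewrite ler_wsqrtr.
apply: le_trans (norm_L2_derive1_le T u); rewrite /norm_L2 ler_wsqrtr//.
by apply: Rintegral_sqr_coord_le Lu _ _ _ _.
Qed.

(** Absolute continuity for a single interval. Only interior points are concerned, because the
    values of [u] outside [[0, T]] are arbitrary. *)
Lemma in_H1_continuous T u : in_H1 T u -> {in `]0, T[%classic, continuous u}.
Proof.
move=> [ac _ _] t; rewrite inE/= in_itv/= => /andP[t0 tT].
apply/cvgrPdist_lt => /= e /ac[delta d0 h].
have aux a b : 0 <= a -> a <= b -> b <= T -> b - a < delta ->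
    enorm (u b - u a) < e.
  move=> a0 ab bT bad; have := h 1 (fun=> a) (fun=> b).
  rewrite !big_ord1; apply => //.
  by apply/trivIsetP => j k _ _; rewrite (ord1 j) (ord1 k) eqxx.
near=> y.
have y0 : 0 < y by near: y; exact: lt_nbhsr.
have yT : y < T by near: y; exact: lt_nbhsl.
have yd : `|t - y| < delta.
  by near: y; exact: (@cvgr_dist_lt _ _ _ _ _ id t).
apply: le_lt_trans (normr_le_enorm _) _.
have [ty|yt] := leP t y.
  rewrite enorm_distC aux// ?(ltW t0) ?(ltW yT)// (le_lt_trans _ yd)//.
  by rewrite distrC ler_norm.
by rewrite aux// ?ltW// (le_lt_trans _ yd)// ler_norm.
Unshelve. all: by end_near. Qed.

Lemma in_H1_measurable_comp T u (k : 'rV[R]_d -> 'rV[R]_d) : continuous k ->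
  in_H1 T u -> coord_measurable T (k \o u).
Proof.
move=> ck Hu i; apply: open_continuous_measurable_fun; first exact: interval_open.
move=> t tT.
have cku : {for t, continuous (k \o u)}.
  by apply: continuous_comp; [exact: in_H1_continuous Hu t tT|exact: ck].
exact: (continuous_comp cku (@coord_continuous _ _ _ ord0 i _)).
Qed.

Lemma in_H1_measurable T u : in_H1 T u -> coord_measurable T u.
Proof. by move=> Hu; apply: (in_H1_measurable_comp T u id) => // x; exact: cvg_id. Qed.

(** The infimum is attained: after division by [norm_X T u] the quotient is a lower bound of the
    admissible constants. If the norm vanishes, the crude embedding already gives zero. *)
Lemma enorm_le_const_max T u t : 0 < T -> in_H1 T u -> t \in `[0, T] ->
  enorm (u t) <= const_max d T * norm_X T u.
Proof.
move=> T0 Hu tT; have emb := sobolev_embedding T u t T0 Hu tT.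
have [N0|N0] := eqVneq (norm_X T u) 0.
  by move: emb; rewrite N0 !mulr0.
have Np : 0 < norm_X T u by rewrite lt_neqAle eq_sym N0 norm_X_ge0.
rewrite -ler_pdivrMr//; apply: lb_le_inf.
  exists (d%:R * (1 + Num.sqrt T)); split; first by rewrite mulr_ge0// addr_ge0.
  by move=> w Hw s; exact: sobolev_embedding.
by move=> c [c0 hc]; rewrite ler_pdivrMr//; exact: hc.
Qed.

Lemma in_H1_bounded_integrable T u : 0 < T -> in_H1 T u ->
  mu.-integrable `]0, T[ (EFin \o (fun t => enorm (u t) ^+ 2)).
Proof.
move=> T0 Hu; have t0 : 0 \in `[0, T] by rewrite in_itv/= lexx ltW.
apply: (@measurable_bounded_integrable_oo _ _ _ ((const_max d T * norm_X T u) ^+ 2)).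
  by apply: measurable_sqr_enorm; exact: in_H1_measurable.
move=> t tT; rewrite ger0_norm ?sqr_ge0// ler_pXn2r ?nnegrE ?enorm_ge0//; last first.
  exact: le_trans (enorm_ge0 _) (enorm_le_const_max T u 0 T0 Hu t0).
by apply: enorm_le_const_max => //; exact: subset_itv_oo_cc.
Qed.

Lemma norm_L2_embedding T u : 0 < T -> in_H1 T u ->
  norm_L2 T u <= Num.sqrt T * `|const_max d T| * norm_X T u.
Proof.
move=> T0 Hu; set c := const_max d T.
have t0 : 0 \in `[0, T] by rewrite in_itv/= lexx ltW.
rewrite -(@ler_pXn2r _ 2)// ?nnegrE ?mulr_ge0 ?sqrtr_ge0//.
rewrite sqr_norm_L2 !exprMn sqr_sqrtr ?(ltW T0)// real_normK ?num_real//.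
apply: (@le_trans _ _ (\int[mu]_(t in `]0, T[) (c ^+ 2 * norm_X T u ^+ 2))).
  apply: le_Rintegral => //.
  - exact: in_H1_bounded_integrable.
  - by apply: (@measurable_bounded_integrable_oo _ _ _ `|c ^+ 2 * norm_X T u ^+ 2|).
  move=> t tT; rewrite -exprMn ler_pXn2r ?nnegrE ?enorm_ge0//; last first.
    exact: le_trans (enorm_ge0 _) (enorm_le_const_max T u 0 T0 Hu t0).
  by apply: enorm_le_const_max => //; exact: subset_itv_oo_cc.
rewrite Rintegral_cst//; set m := fine _; suff -> : m = T by rewrite [leLHS]mulrC mulrA.
apply: (@eq_trans _ _ (fine (mu `]0, T[))); first by [].
by rewrite lebesgue_measure_oo ?ltW// subr0.
Qed.

Lemma const_L2_ge0 T : 0 < T -> 0 <= const_L2 (R := R) d T.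
Proof.
move=> T0; apply: lb_le_inf; last by move=> c [].
exists (Num.sqrt T * `|const_max d T|); split.
  by rewrite mulr_ge0// sqrtr_ge0.
by move=> w Hw; exact: norm_L2_embedding.
Qed.

Lemma norm_L2_le_const_L2 T u : 0 < T -> in_H1 T u ->
  norm_L2 T u <= const_L2 d T * norm_X T u.
Proof.
move=> T0 Hu; have emb := norm_L2_embedding T u T0 Hu.
have [N0|N0] := eqVneq (norm_X T u) 0.
  by move: emb; rewrite N0 !mulr0.
have Np : 0 < norm_X T u by rewrite lt_neqAle eq_sym N0 norm_X_ge0.
rewrite -ler_pdivrMr//; apply: lb_le_inf.
  exists (Num.sqrt T * `|const_max d T|); split.
    by rewrite mulr_ge0// sqrtr_ge0.
  by move=> w Hw; exact: norm_L2_embedding.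
by move=> c [c0 hc]; rewrite ler_pdivrMr//; exact: hc.
Qed.

Lemma in_H1_cst T (c : 'rV[R]_d) : in_H1 T (cst c).
Proof.
have dc : derive1 (cst c : R -> 'rV[R]_d) = cst 0.
  by apply/funext => t; rewrite derive1_cst.
split.
- move=> e e0; exists 1 => // n a b _ _ _.
  by rewrite big1// => i _; rewrite subrr enorm0.
- by apply: aeW => t _; exact: derivable_cst.
- split=> [i|].
    by rewrite dc; exact: measurable_cst.
  rewrite dc; under eq_integral do rewrite /= enorm0 expr0n.
  by rewrite integral0.
Qed.

(** Test with a constant unit vector. Positivity is what turns [norm_X < r] into the strict
    inequality that defines the tube. *)
Lemma const_max_gt0 T : (0 < d)%N -> 0 < T -> 0 < const_max (R := R) d T.
Proof.
move=> d0 T0; pose c : 'rV[R]_d := delta_mx ord0 (Ordinal d0).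
have c1 : enorm c = 1.
  rewrite /enorm /dot (bigD1 (Ordinal d0))//= big1 ?addr0 => [|i /negPf ni].
    by rewrite !mxE !eqxx mulr1 sqrtr1.
  by rewrite !mxE ni andbF mulr0.
have t0 : 0 \in `[0, T] by rewrite in_itv/= lexx ltW.
have := enorm_le_const_max T (cst c) 0 T0 (in_H1_cst T c) t0.
rewrite /= c1; have [//|cm] := ltP 0 (const_max d T) => /(lt_le_trans ltr01).
by rewrite ltNge mulr_le0_ge0// norm_X_ge0.
Qed.

End sobolev.

Lemma is_derive_affine {R : realType} {V : normedModType R} (a b : V) (t : R) :
  is_derive t 1 (fun t : R => a + t *: b) b.
Proof.
have h : (fun h : R => h^-1 *: (((fun t => a + t *: b) \o shift t) (h *: 1)
    - (a + t *: b))) @ 0^' --> b.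
  apply: cvg_near_cst; near=> h.
  have h0 : h != 0 by near: h; exact: nbhs_dnbhs_neq.
  rewrite /= [h *: 1]mulr1 opprD addrACA subrr add0r -scalerBl addrK.
  by rewrite scalerA mulVf// scale1r.
split; first by apply/cvg_ex; exists b.
by apply: cvg_lim => //; exact: norm_hausdorff.
Unshelve. all: by end_near. Qed.

(** * Finite elements *)

Section nodes.
Context {R : realType}.
Implicit Types (T : R) (s : seq R).
Notation mu := (@lebesgue_measure R).

Lemma node_lt T s i : itv_partition 0 T s -> (i < size s)%N ->
  node s i < node s i.+1.
Proof. by move=> [/(pathP 0) h _] /h. Qed.

Lemma node_le T s i j : itv_partition 0 T s -> (i <= j)%N -> (j <= size s)%N ->
  node s i <= node s j.
Proof.
move=> hs; elim: j => [|j ih]; first by rewrite leqn0 => /eqP ->.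
rewrite leq_eqVlt => /predU1P[->//|ij] js.
exact: le_trans (ih ij (ltnW js)) (ltW (node_lt _ _ _ hs js)).
Qed.

Lemma node_size T s : itv_partition 0 T s -> node s (size s) = T.
Proof. exact: itv_partition_nth_size. Qed.

Lemma node_ge0 T s i : itv_partition 0 T s -> (i <= size s)%N -> 0 <= node s i.
Proof. by move=> hs is_; exact: (node_le _ _ 0 _ hs). Qed.

Lemma node_leT T s i : itv_partition 0 T s -> (i <= size s)%N -> node s i <= T.
Proof. by move=> hs is_; rewrite -[leRHS](node_size _ _ hs) (node_le _ _ _ _ hs). Qed.

Lemma node_mesh s i : (i < size s)%N -> node s i.+1 - node s i <= mesh s.
Proof.
move=> is_; rewrite /mesh.
exact: (le_bigmax _ (fun i : 'I_(size s) => node s i.+1 - node s i) (Ordinal is_)).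
Qed.

Lemma mesh_ge0 s : 0 <= mesh s.
Proof. exact: bigmax_ge_id. Qed.

Lemma node_locate s t m : 0 < t -> t <= node s m ->
  exists2 k, (k < m)%N & node s k < t <= node s k.+1.
Proof.
elim: m => [|m ih] t0; first by move=> /(lt_le_trans t0); rewrite ltxx.
move=> tm; have [/(ih t0)[k km hk]|mt] := leP t (node s m).
  by exists k => //; exact: ltnW.
by exists m => //; rewrite mt.
Qed.

Lemma node_locate_notin T s t : itv_partition 0 T s -> t \in `]0, T[ ->
  t \notin s -> exists2 k, (k < size s)%N & t \in `]node s k, node s k.+1[.
Proof.
move=> hs; rewrite in_itv/= => /andP[t0 tT] ts.
have [|k ks /andP[kt tk]] := node_locate s t (size s) t0.
  by rewrite (node_size _ _ hs) ltW.
exists k => //; rewrite in_itv/= kt lt_neqAle tk andbT.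
by apply: contraNneq ts => ->; rewrite /node /= mem_nth.
Qed.

Lemma node_locate_ae T s : itv_partition 0 T s ->
  {ae mu, forall t, t \in `]0, T[ ->
    exists2 k, (k < size s)%N & t \in `]node s k, node s k.+1[}.
Proof.
move=> hs; exists [set` s].
have cs : countable [set` s] by exact: finite_set_countable.
split.
- exact: countable_measurable.
- exact: countable_lebesgue_measure0.
move=> t /= /not_implyP[tT nk]; apply: contrapT => /negP ts.
exact: nk (node_locate_notin _ _ _ hs tT ts).
Qed.

Lemma Rintegral_node_split T s (phi : R -> R) : itv_partition 0 T s ->
  mu.-integrable `]0, T[ (EFin \o phi) ->
  \int[mu]_(t in `]0, T[) phi t =
  \sum_(k < size s) \int[mu]_(t in `]node s k, node s k.+1[) phi t.
Proof.
move=> hs iphi; rewrite -[X in `]_, X[](node_size _ _ hs).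
suff h m : (m <= size s)%N -> \int[mu]_(t in `]0, node s m[) phi t =
    \sum_(k < m) \int[mu]_(t in `]node s k, node s k.+1[) phi t by exact: h.
elim: m => [|m ih] ms.
  by rewrite big_ord0 set_itv_ge ?bnd_simp// Rintegral_set0.
have n0 := node_ge0 _ _ _ hs (ltnW ms).
have i1 : mu.-integrable `]0, node s m.+1[ (EFin \o phi).
  by apply: (integrable_subset_oo T) => //; exact: node_leT hs ms.
rewrite big_ord_recr /= -(ih (ltnW ms)).
rewrite -(@Rintegral_itvB _ phi (BRight 0) (BLeft (node s m.+1)) (node s m)) //.
- rewrite -Rintegral_itv_bndo_bndc; first by rewrite addrC subrK.
  apply: (integrable_subset_oo T) => //.
  exact: node_leT hs (ltnW ms).
- by rewrite bnd_simp (node_lt _ _ _ hs).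
Qed.

End nodes.

Section finite_elements.
Context {R : realType} {d : nat}.
Implicit Types (T : R) (s : seq R) (u v : R -> 'rV[R]_d).
Notation mu := (@lebesgue_measure R).

Lemma fe_spaceD T s u v c : fe_space d T s u -> fe_space d T s v ->
  fe_space d T s (fun t => u t + c *: v t).
Proof.
move=> [cu hu] [cv hv]; split.
  move=> x; apply: cvgD; first exact: cu.
  by apply: cvgZ; [exact: cvg_cst|exact: cv].
move=> i is_; have [a [b hab]] := hu i is_; have [a' [b' hab']] := hv i is_.
exists (a + c *: a'), (b + c *: b') => t ti.
rewrite hab// hab'// !scalerDr addrACA; congr (_ + (_ + _)).
by rewrite !scalerA mulrC.
Qed.

Lemma fe_spaceB T s u v : fe_space d T s u -> fe_space d T s v ->
  fe_space d T s (fun t => u t - v t).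
Proof.
by move=> hu hv; under eq_fun do rewrite -scaleN1r; exact: fe_spaceD.
Qed.

(** Clamping [t] to [[a, b]] gives a function equal to zero before [a], of slope [c] on [[a, b]] and
    constant afterwards. Between consecutive nodes it is a finite element function whose derivative
    lives on one element only, which localizes a global first-order condition. *)
Definition ramp (a b : R) (c : 'rV[R]_d) : R -> 'rV[R]_d :=
  fun t => (Num.min (Num.max t a) b - a) *: c.

Lemma fe_space_ramp T s k c : itv_partition 0 T s -> (k < size s)%N ->
  fe_space d T s (ramp (node s k) (node s k.+1) c).
Proof.
move=> hs ks; have kk := ltW (node_lt _ _ _ hs ks).
split.
  apply: continuous_subspaceT => t; apply: cvgZ; last exact: cvg_cst.
  apply: cvgB; last exact: cvg_cst.
  apply: (@continuous_min _ _ (fun t => Num.max t (node s k)) (cst _)).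
    by apply: (@continuous_max _ _ id (cst _)); [exact: cvg_id|exact: cvg_cst].
  exact: cvg_cst.
move=> i is_; have [ik|ki|->] := ltngtP i k.
- exists 0, 0 => t; rewrite in_itv/= => /andP[_ ti].
  have tk : t <= node s k by rewrite (le_trans ti)// (node_le _ _ _ _ hs)// ltnW.
  by rewrite /ramp (max_r tk) (min_l kk) subrr scale0r scaler0 addr0.
- exists ((node s k.+1 - node s k) *: c), 0 => t; rewrite in_itv/= => /andP[it _].
  have kt : node s k.+1 <= t by rewrite (le_trans _ it)// (node_le _ _ _ _ hs)// ltnW.
  by rewrite /ramp (max_l (le_trans kk kt)) (min_r kt) scaler0 addr0.
- exists (- node s k *: c), c => t; rewrite in_itv/= => /andP[kt tk].
  by rewrite /ramp (max_l kt) (min_l tk) -scalerDl addrC.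
Qed.

Lemma ramp0 a b c : 0 <= a -> a <= b -> ramp a b c 0 = 0.
Proof. by move=> a0 ab; rewrite /ramp (max_r a0) (min_l ab) subrr scale0r. Qed.

Lemma derive1_affine_on u (a b : R) (p q : 'rV[R]_d) (t : R) :
  (forall t, t \in `[a, b] -> u t = p + t *: q) -> t \in `]a, b[ ->
  derivable u t 1 /\ derive1 u t = q.
Proof.
move=> hu tab.
have E : \forall x \near t, p + x *: q = u x.
  near=> x; rewrite hu//; apply: subset_itv_oo_cc.
  by near: x; exact: near_in_itvoo.
have h := near_eq_is_derive E (is_derive_affine p q t).
by rewrite derive1E; case: h.
Unshelve. all: by end_near. Qed.

(* The derivative of [u] on the [k]-th element. *)
Definition slope s u k : 'rV[R]_d :=
  (node s k.+1 - node s k)^-1 *: (u (node s k.+1) - u (node s k)).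

Lemma fe_spaceE T s u k t : itv_partition 0 T s -> fe_space d T s u ->
  (k < size s)%N -> t \in `[node s k, node s k.+1] ->
  u t = u (node s k) + (t - node s k) *: slope s u k.
Proof.
move=> hs [_ hu] ks tk; have [a [b hab]] := hu k ks.
have lk := node_lt _ _ _ hs ks.
have h1 := hab (node s k); have h2 := hab (node s k.+1).
have -> : slope s u k = b.
  rewrite /slope h1 ?in_itv/= ?lexx ?ltW// h2 ?in_itv/= ?lexx ?ltW//.
  rewrite opprD addrACA subrr add0r -scalerBl scalerA mulVf ?scale1r//.
  by rewrite subr_eq0 gt_eqF.
rewrite h1 ?in_itv/= ?lexx ?ltW// hab// scalerBl.
by rewrite [t *: b - _]addrC addrA addrK.
Qed.

Lemma fe_space_derive1 T s u k t : itv_partition 0 T s -> fe_space d T s u ->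
  (k < size s)%N -> t \in `]node s k, node s k.+1[ ->
  derivable u t 1 /\ derive1 u t = slope s u k.
Proof.
move=> hs hu ks tk.
apply: (derive1_affine_on _ (node s k) (node s k.+1)
  (u (node s k) - node s k *: slope s u k)) => // x xk.
by rewrite (fe_spaceE _ _ _ _ _ hs hu ks xk) scalerBl addrCA addrC.
Qed.

Lemma fe_space_derivable T s u : itv_partition 0 T s -> fe_space d T s u ->
  {ae mu, forall t, t \in `]0, T[ -> derivable u t 1}.
Proof.
move=> hs hu; have aeF := ae_filter_ringOfSetsType mu.
apply: (@filterS _ _ aeF _ _ _ (node_locate_ae _ _ hs)) => t h /h[k ks tk].
by case: (fe_space_derive1 _ _ _ _ _ hs hu ks tk).
Qed.

(** The sum of the norms of all slopes is a Lipschitz constant on every element; the induction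
    splits an increment at the last node that it crosses. *)
Lemma fe_space_lipschitz T s u : itv_partition 0 T s -> fe_space d T s u ->
  exists2 M : R, 0 <= M & forall a b, 0 <= a -> a <= b -> b <= T ->
    enorm (u b - u a) <= M * (b - a).
Proof.
move=> hs hu; rewrite -(node_size _ _ hs).
exists (\sum_(k < size s) enorm (slope s u k)).
  by apply: sumr_ge0 => k _; exact: enorm_ge0.
set M := \sum_(k < _) _.
have hM k : (k < size s)%N -> enorm (slope s u k) <= M.
  move=> ks; rewrite /M (bigD1 (Ordinal ks))//= lerDl.
  by apply: sumr_ge0 => j _; exact: enorm_ge0.
have hel k a b : (k < size s)%N -> node s k <= a -> a <= b ->
    b <= node s k.+1 -> enorm (u b - u a) <= M * (b - a).
  move=> ks ka ab bk.
  rewrite (fe_spaceE _ _ _ _ b hs hu ks) ?in_itv/= ?bk ?(le_trans ka)//.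
  rewrite (fe_spaceE _ _ _ _ a hs hu ks) ?in_itv/= ?ka ?(le_trans ab)//.
  rewrite opprD addrACA subrr add0r -scalerBl opprB addrA subrK.
  by rewrite enormZ ger0_norm ?subr_ge0// mulrC ler_wpM2r ?subr_ge0// hM.
suff h m a b : (m <= size s)%N -> 0 <= a -> a <= b -> b <= node s m ->
  enorm (u b - u a) <= M * (b - a) by move=> a b; exact: h.
elim: m a b => [|m ih] a b ms a0 ab bm.
  have b0 : b = 0 by apply/eqP; rewrite eq_le (le_trans a0 ab) bm.
  have -> : a = 0 by apply/eqP; rewrite eq_le a0 -{1}b0 ab.
  by rewrite b0 !subrr mulr0 enorm0.
have [bm'|mb] := leP b (node s m); first exact: ih (ltnW ms) _ _ _.
have [am|ma] := leP a (node s m); last exact: hel ms (ltW ma) _ _.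
have -> : u b - u a = (u b - u (node s m)) + (u (node s m) - u a).
  by rewrite addrA subrK.
rewrite (le_trans (enormD _ _))//.
have -> : M * (b - a) = M * (b - node s m) + M * (node s m - a).
  by rewrite -mulrDr addrA subrK.
rewrite lerD//; first by apply: hel ms _ _ _ => //; exact: ltW.
exact: ih (ltnW ms) _ _ _.
Qed.

(** The derivative is constant on each open element, and whatever value [derive1] takes at a node, a
    function on a singleton is measurable. *)
Lemma fe_space_derive1_measurable T s u : itv_partition 0 T s ->
  fe_space d T s u -> coord_measurable T (derive1 u).
Proof.
move=> hs hu i; rewrite -[X in `]_, X[](node_size _ _ hs).
suff h m : (m <= size s)%N ->
  measurable_fun `]0, node s m[ (fun t => derive1 u t ord0 i) by exact: h.
elim: m => [|m ih] ms.
  by rewrite set_itv_ge ?bnd_simp//; exact: measurable_fun_set0.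
have lm := node_lt _ _ _ hs ms; have m0 := node_ge0 _ _ _ hs (ltnW ms).
apply: (@measurable_funS _ _ _ _
    (`]0, node s m[ `|` ([set node s m] `|` `]node s m, node s m.+1[))).
- by apply: measurableU => //; exact: measurableU.
- move=> t /=; rewrite !in_itv/= => /andP[t0 tm].
  have [tm'|mt|->] := ltgtP t (node s m); last by right; left.
    by left; rewrite t0.
  by right; right; rewrite tm.
apply/measurable_funU => //; first exact: measurableU.
split; first exact: ih (ltnW ms).
apply/measurable_funU => //; split; first exact: measurable_fun_set1.
apply: (eq_measurable_fun (cst (slope s u m ord0 i))); last exact: measurable_cst.
move=> t; rewrite inE/= => tm.
by case: (fe_space_derive1 _ _ _ _ _ hs hu ms tm) => _ ->.
Qed.

Lemma fe_space_derive1_bounded T s u : itv_partition 0 T s ->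
  fe_space d T s u -> exists2 M : R, 0 <= M &
    forall t, t \in `]0, T[ -> enorm (derive1 u t) <= M.
Proof.
move=> hs hu; rewrite -(node_size _ _ hs).
suff h m : (m <= size s)%N -> exists2 M : R, 0 <= M &
  forall t, t \in `]0, node s m[ -> enorm (derive1 u t) <= M by exact: h.
elim: m => [|m ih] ms.
  exists 0 => // t; rewrite in_itv/= => /andP[/lt_trans h /h].
  by rewrite ltxx.
have [M M0 hM] := ih (ltnW ms).
(* At a kink [derive1] has some unspecified value, which the bound must include. *)
exists (M + enorm (derive1 u (node s m)) + enorm (slope s u m)).
  by rewrite !addr_ge0 ?enorm_ge0.
move=> t; rewrite in_itv/= => /andP[t0 tm].
have e1 := enorm_ge0 (derive1 u (node s m)); have e2 := enorm_ge0 (slope s u m).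
have [tm'|mt|->] := ltgtP t (node s m).
- have h : enorm (derive1 u t) <= M by apply: hM; rewrite in_itv/= t0 tm'.
  by rewrite (le_trans h)// -addrA lerDl addr_ge0.
- have [|_ ->] := fe_space_derive1 _ _ _ _ t hs hu ms; last by lra.
  by rewrite in_itv/= mt.
- lra.
Qed.

Lemma fe_space_in_H1 T s u : itv_partition 0 T s -> fe_space d T s u ->
  in_H1 T u.
Proof.
move=> hs hu; split.
- move=> e e0; have [M M0 hM] := fe_space_lipschitz _ _ _ hs hu.
  exists (e / (M + 1)); first by rewrite divr_gt0// ltr_wpDl.
  move=> n a b hab _; rewrite ltr_pdivlMr ?ltr_wpDl// => h.
  apply: (@le_lt_trans _ _ (M * \sum_(i < n) (b i - a i))).
    rewrite mulr_sumr; apply: ler_sum => i _.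
    by have [? [? ?]] := hab i; exact: hM.
  apply: le_lt_trans h; rewrite mulrC ler_wpM2l ?lerDl//.
  by apply: sumr_ge0 => i _; have [? [? ?]] := hab i; rewrite subr_ge0.
- exact: fe_space_derivable hs hu.
have mdu := fe_space_derive1_measurable _ _ _ hs hu.
split=> //; have [M M0 hM] := fe_space_derive1_bounded _ _ _ hs hu.
have : mu.-integrable `]0, T[ (EFin \o (fun t => enorm (derive1 u t) ^+ 2)).
  apply: (@measurable_bounded_integrable_oo _ _ _ (M ^+ 2)).
    exact: measurable_sqr_enorm mdu.
  move=> t tT; rewrite ger0_norm ?sqr_ge0//.
  by rewrite ler_pXn2r ?nnegrE ?enorm_ge0// hM.
move=> /integrableP[_]; apply: le_lt_trans; rewrite le_eqVlt; apply/orP; left.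
apply/eqP/eq_integral => t _ /=; rewrite ger0_norm ?sqr_ge0//.
Qed.

End finite_elements.

Lemma first_order_eq0 {R : realType} (A K : R) : 0 <= K ->
  (forall eps, `|eps| <= 1 -> 0 <= eps * A *+ 2 + eps ^+ 2 * K) -> A = 0.
Proof.
move=> K0 h; apply/eqP/negPn/negP => A0.
(* For [eps = - A / D] this choice ensures [|eps| <= 1] and [2 * D > K], so that the quadratic takes
   the negative value [- (A / D)^2 * (2 * D - K)]. *)
pose D := K + `|A| + 1.
have D0 : 0 < D by rewrite /D; have := normr_ge0 A; lra.
have := h (- A / D); rewrite normrM normrN normfV (gtr0_norm D0).
rewrite ler_pdivrMr// mul1r.
have -> : `|A| <= D by rewrite /D; lra.
move=> /(_ isT).
have -> : - A / D * A *+ 2 + (- A / D) ^+ 2 * K = - (A ^+ 2 / D ^+ 2 * (2 * D - K)).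
  by field; rewrite gt_eqF.
rewrite oppr_ge0 leNgt => /negP; apply.
have h1 : 0 < 2 * D - K by rewrite /D; have := normr_ge0 A; lra.
have h2 : 0 < A ^+ 2 by rewrite exprn_even_gt0.
by rewrite mulr_gt0// divr_gt0// exprn_gt0.
Qed.

(** * First variations of the least-squares functionals *)

Section first_variation.
Context {R : realType} {d : nat}.
Implicit Types (T : R) (s : seq R) (u v : R -> 'rV[R]_d).
Notation mu := (@lebesgue_measure R).

Lemma coord_measurableD T u v : coord_measurable T u -> coord_measurable T v ->
  coord_measurable T (fun t => u t + v t).
Proof.
move=> mu_ mv i; rewrite (_ : (fun t => _) = (fun t => u t ord0 i + v t ord0 i)).
  exact: measurable_funD.
by apply/funext => t; rewrite mxE.
Qed.

Lemma coord_measurableZ T c u : coord_measurable T u ->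
  coord_measurable T (fun t => c *: u t).
Proof.
move=> mu_ i; rewrite (_ : (fun t => _) = (fun t => c * u t ord0 i)).
  by apply: measurable_funM; [exact: measurable_cst|exact: mu_].
by apply/funext => t; rewrite mxE.
Qed.

Lemma coord_measurableB T u v : coord_measurable T u -> coord_measurable T v ->
  coord_measurable T (fun t => u t - v t).
Proof.
move=> mu_ mv i; rewrite (_ : (fun t => _) = (fun t => u t ord0 i - v t ord0 i)).
  exact: measurable_funB.
by apply/funext => t; rewrite !mxE.
Qed.

Lemma integrable_dot_bounded T u v (M N : R) :
  coord_measurable T u -> coord_measurable T v ->
  (forall t, t \in `]0, T[ -> enorm (u t) <= M) ->
  (forall t, t \in `]0, T[ -> enorm (v t) <= N) ->
  mu.-integrable `]0, T[ (EFin \o (fun t => dot (u t) (v t))).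
Proof.
move=> mu_ mv hM hN.
apply: (@measurable_bounded_integrable_oo _ _ _ (M * N)).
  exact: measurable_dot.
move=> t tT; rewrite (le_trans (abs_dot_le _ _))// ler_pM ?enorm_ge0//.
  exact: hM.
exact: hN.
Qed.

Lemma integrable_sqr_bounded T u (M : R) :
  coord_measurable T u -> (forall t, t \in `]0, T[ -> enorm (u t) <= M) ->
  mu.-integrable `]0, T[ (EFin \o (fun t => enorm (u t) ^+ 2)).
Proof.
move=> mu_ hM; have := integrable_dot_bounded _ _ _ _ _ mu_ mu_ hM hM.
by apply: eq_integrable => // t _ /=; rewrite sqr_enorm.
Qed.

Lemma norm_L2_ae_eq T u v : coord_measurable T v ->
  {ae mu, forall t, t \in `]0, T[ -> u t = v t} ->
  norm_L2 T u = norm_L2 T v.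
Proof.
move=> mv [N [mN N0 hN]]; rewrite /norm_L2 /Rintegral; congr (Num.sqrt (fine _)).
apply: (ge0_integral_eq_off_null _ _ _ _ _ N) => //.
- by apply/measurable_EFinP; exact: measurable_sqr_enorm mv.
- by move=> t _; rewrite lee_fin sqr_ge0.
- by move=> t _; rewrite lee_fin sqr_ge0.
move=> t tT Nt; congr ((enorm _ ^+ 2)%:E); apply: contrapT => ne.
by apply/Nt/hN => /= h; apply/ne/h.
Qed.

(** One statement for both functionals: the perturbed residual [r eps] is [r0 + eps *: S] up to a
    uniform error of order [eps^2]. That error is zero for [J_lin] and a Taylor remainder for
    [J]. *)
Lemma first_variation T (r : R -> R -> 'rV[R]_d) (r0 S : R -> 'rV[R]_d)
    (a b : 'rV[R]_d) (M : R) : 0 < T -> 0 <= M ->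
  (forall eps, coord_measurable T (r eps)) ->
  coord_measurable T r0 -> coord_measurable T S ->
  (forall t, t \in `]0, T[ -> enorm (r0 t) <= M) ->
  (forall t, t \in `]0, T[ -> enorm (S t) <= M) ->
  (forall eps t, `|eps| <= 1 -> t \in `]0, T[ ->
    enorm (r eps t - r0 t - eps *: S t) <= M * eps ^+ 2) ->
  (forall eps, `|eps| <= 1 ->
    2^-1 * norm_L2 T r0 ^+ 2 + 2^-1 * enorm a ^+ 2 <=
    2^-1 * norm_L2 T (r eps) ^+ 2 + 2^-1 * enorm (a + eps *: b) ^+ 2) ->
  \int[mu]_(t in `]0, T[) dot (r0 t) (S t) + dot a b = 0.
Proof.
move=> T0 M0 mr mr0 mS hr hS hrem hmin.
set A := \int[mu]_(t in _) _.
(* Let [q] be the remainder, of norm at most [M * eps^2]. Expanding the square of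
   [r0 + eps *: S + q], the products of [q] with [r0] and with [eps *: S] count twice each, the
   squares of [q] and of [eps *: S] once each: six terms bounded by [M^2 * eps^2]. *)
apply: (first_order_eq0 _ (6 * M ^+ 2 * T + enorm b ^+ 2)).
  by rewrite addr_ge0 ?sqr_ge0// mulr_ge0 ?(ltW T0)// mulr_ge0 ?sqr_ge0.
move=> eps eps1.
have eps2 : eps ^+ 2 <= 1.
  by rewrite -real_normK ?num_real// expr_le1.
have := hmin eps eps1; rewrite !sqr_norm_L2.
have i0 := integrable_sqr_bounded _ _ _ mr0 hr.
have iS := integrable_dot_bounded _ _ _ _ _ mr0 mS hr hS.
have hre t : t \in `]0, T[ -> enorm (r eps t) <= M + (M + M).
  move=> tT; have -> : r eps t =
      r0 t + (eps *: S t + (r eps t - r0 t - eps *: S t)).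
    by apply/rowP => i; rewrite !mxE; ring.
  rewrite (le_trans (enormD _ _))// lerD ?hr// (le_trans (enormD _ _))// lerD//.
    by rewrite enormZ (le_trans _ (hS t tT))// ler_piMl ?enorm_ge0.
  by rewrite (le_trans (hrem _ _ eps1 tT))// ler_piMr.
have ie := integrable_sqr_bounded _ _ _ (mr eps) hre.
have i1 : mu.-integrable `]0, T[ (EFin \o (fun t => (eps *+ 2) * dot (r0 t) (S t))).
  exact: (integrableZl _ _ iS).
have ic : mu.-integrable `]0, T[ (EFin \o (cst (6 * M ^+ 2 * eps ^+ 2) : R -> R)).
  by apply: (@measurable_bounded_integrable_oo _ _ _ `|6 * M ^+ 2 * eps ^+ 2|).
have le1 : \int[mu]_(t in `]0, T[) enorm (r eps t) ^+ 2 <=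
    \int[mu]_(t in `]0, T[) enorm (r0 t) ^+ 2 + (eps *+ 2) * A
      + 6 * M ^+ 2 * eps ^+ 2 * T.
  apply: (@le_trans _ _ (\int[mu]_(t in `]0, T[) (enorm (r0 t) ^+ 2 +
     (eps *+ 2) * dot (r0 t) (S t) + 6 * M ^+ 2 * eps ^+ 2))).
    apply: le_Rintegral => //.
      exact: (integrableD _ (integrableD _ i0 i1) ic).
    move=> t tT.
    have := hrem eps t eps1 tT.
    have [q qE] : exists q, q = r eps t - r0 t - eps *: S t by eexists.
    rewrite -qE => hq.
    have -> : r eps t = r0 t + eps *: S t + q.
      by rewrite qE; apply/rowP => i; rewrite !mxE; ring.
    have h0 := hr t tT; have h1 := hS t tT.
    have h2 := abs_dot_le (r0 t) q; have h3 := abs_dot_le (S t) q.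
    have e0 := enorm_ge0 (r0 t); have e1 := enorm_ge0 (S t).
    have eq := enorm_ge0 q; have e2 := sqr_ge0 eps.
    have hqM : enorm q <= M by rewrite (le_trans hq)// ler_piMr.
    have b1 : dot (r0 t) q <= M * (M * eps ^+ 2).
      by rewrite (le_trans (ler_norm _))// (le_trans h2)// ler_pM.
    have b2 : eps * dot (S t) q <= M * (M * eps ^+ 2).
      rewrite (le_trans (ler_norm _))// normrM.
      by rewrite (le_trans (ler_piMl _ eps1))// (le_trans h3)// ler_pM.
    have b3 : enorm q ^+ 2 <= M * (M * eps ^+ 2) by rewrite expr2 ler_pM.
    have b4 : eps ^+ 2 * enorm (S t) ^+ 2 <= M * (M * eps ^+ 2).
      by rewrite mulrC mulrA -expr2 ler_wpM2r// ler_pXn2r ?nnegrE.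
    rewrite !sqr_enorm in b3 b4 *.
    rewrite !(dotDl, dotDr, dotZl, dotZr).
    rewrite (dotC q (r0 t)) (dotC q (S t)) (dotC (S t) (r0 t)).
    have -> : 6 * M ^+ 2 * eps ^+ 2 = 6 * (M * (M * eps ^+ 2)) by ring.
    move: b1 b2 b3 b4; set B := M * _; rewrite expr2 -mulrA => b1 b2 b3 b4.
    lra.
  rewrite RintegralD//; last exact: (integrableD _ i0 i1).
  rewrite RintegralD// [X in _ + X + _]RintegralZl// lerD2l Rintegral_cst//.
  set m := fine _; suff -> : m = T by [].
  apply: (@eq_trans _ _ (fine (mu `]0, T[))); first by [].
  by rewrite lebesgue_measure_oo ?ltW// subr0.
move: le1; set I0 := \int[mu]_(t in _) _; set I1 := \int[mu]_(t in _) _ => le1.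
rewrite !sqr_enorm !(dotDl, dotDr, dotZl, dotZr) (dotC b a) => h.
have -> : eps ^+ 2 * (6 * M ^+ 2 * T + dot b b) =
  6 * M ^+ 2 * eps ^+ 2 * T + eps * (eps * dot b b) by ring.
move: le1 h; set B := 6 * _ * _ * _ => le1 h.
by lra.
Qed.

Lemma in_H1_bounded T u : 0 < T -> in_H1 T u ->
  exists2 M : R, 0 <= M & forall t, t \in `[0, T] -> enorm (u t) <= M.
Proof.
move=> T0 Hu; exists `|const_max d T * norm_X T u| => // t tT.
by rewrite (le_trans (enorm_le_const_max _ _ _ T0 Hu tT))// ler_norm.
Qed.

Lemma fe_space_derive1D T s u v c : itv_partition 0 T s ->
  fe_space d T s u -> fe_space d T s v ->
  {ae mu, forall t, t \in `]0, T[ ->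
    derive1 (fun t => u t + c *: v t) t = derive1 u t + c *: derive1 v t}.
Proof.
move=> hs hu hv; have aeF := ae_filter_ringOfSetsType mu.
apply: (@filterS2 _ _ aeF _ _ _ _ (fe_space_derivable _ _ _ hs hu)
  (fe_space_derivable _ _ _ hs hv)) => t du dv tT.
rewrite !derive1E deriveD//; first by rewrite deriveZ//; exact: dv.
- exact: du.
- by apply: derivableZ; exact: dv.
Qed.

Lemma J_lin_first_variation T s F f g (z w v : R -> 'rV[R]_d) : 0 < T ->
  itv_partition 0 T s -> continuous F -> in_H1 T f -> in_H1 T z ->
  minimizer_on (fe_space d T s) (J_lin T F f g z) w -> fe_space d T s v ->
  \int[mu]_(t in `]0, T[) dot (derive1 w t - F (z t) - f t) (derive1 v t)
    + dot (w 0 - g) (v 0) = 0.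
Proof.
move=> T0 hs cF Hf Hz [hw minw] hv.
pose r eps t := derive1 w t + eps *: derive1 v t - F (z t) - f t.
have mdw := fe_space_derive1_measurable _ _ _ hs hw.
have mdv := fe_space_derive1_measurable _ _ _ hs hv.
have mf := in_H1_measurable _ _ Hf.
have mFz : coord_measurable T (F \o z) by exact: in_H1_measurable_comp.
pose r0 t := derive1 w t - F (z t) - f t.
have mr eps : coord_measurable T (r eps).
  apply: coord_measurableB mf; apply: coord_measurableB mFz.
  by apply: (coord_measurableD _ _ _ mdw); exact: coord_measurableZ.
have mr0 : coord_measurable T r0.
  by apply: coord_measurableB mf; exact: coord_measurableB mdw mFz.
have [Mw Mw0 hMw] := fe_space_derive1_bounded _ _ _ hs hw.
have [Mv Mv0 hMv] := fe_space_derive1_bounded _ _ _ hs hv.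
have [Mf Mf0 hMf] := in_H1_bounded _ _ T0 Hf.
have [Mz Mz0 hMz] := in_H1_bounded _ _ T0 Hz.
have [MF MF0 hMF] := bounded_continuous_ball _ Mz cF.
apply: (first_variation T r r0 _ _ _ (Mw + MF + Mf + Mv)) => //.
- by rewrite !addr_ge0.
- move=> t tT; have tT' := subset_itv_oo_cc tT.
  have := enormD (derive1 w t - F (z t)) (- f t).
  have := enormD (derive1 w t) (- F (z t)); rewrite !enormN -/(r0 t).
  have := hMw t tT; have := hMF _ (hMz _ tT'); have := hMf _ tT'.
  by lra.
- by move=> t tT; have := hMv t tT; lra.
- move=> eps t _ _.
  have -> : r eps t - r0 t - eps *: derive1 v t = 0.
    by rewrite /r0 /r; apply/rowP => i; rewrite !mxE; ring.
  by rewrite enorm0 mulr_ge0 ?sqr_ge0// !addr_ge0.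
move=> eps _.
have JE : J_lin T F f g z (fun t => w t + eps *: v t) =
    2^-1 * norm_L2 T (r eps) ^+ 2 + 2^-1 * enorm (w 0 - g + eps *: v 0) ^+ 2.
  have -> : w 0 - g + eps *: v 0 = w 0 + eps *: v 0 - g by rewrite addrAC.
  suff EL : norm_L2 T (fun t => derive1 (fun t => w t + eps *: v t) t
    - F (z t) - f t) = norm_L2 T (r eps) by rewrite -EL.
  apply: norm_L2_ae_eq (mr eps) _.
  have aeF := ae_filter_ringOfSetsType mu.
  apply: (@filterS _ _ aeF _ _ _ (fe_space_derive1D _ _ _ _ eps hs hw hv)).
  by move=> t h /h E; rewrite /r E.
by move: (minw _ (fe_spaceD _ _ _ _ eps hw hv)); rewrite JE; apply.
Qed.

Lemma J_first_variation T s F f g (y v : R -> 'rV[R]_d) : 0 < T ->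
  itv_partition 0 T s -> differentiable_C2 F -> in_H1 T f ->
  minimizer_on (fe_space d T s) (J T F f g) y -> fe_space d T s v ->
  \int[mu]_(t in `]0, T[)
     dot (derive1 y t - F (y t) - f t) (derive1 v t - 'D_(v t) F (y t))
    + dot (y 0 - g) (v 0) = 0.
Proof.
move=> T0 hs C2 Hf [hy miny] hv.
have C1 := differentiable_C2W _ C2.
have cF : continuous F by move=> x; exact/differentiable_continuous/C2.1.
have Hy := fe_space_in_H1 _ _ _ hs hy; have Hv := fe_space_in_H1 _ _ _ hs hv.
pose r eps t := derive1 y t + eps *: derive1 v t - F (y t + eps *: v t) - f t.
pose S t := derive1 v t - 'D_(v t) F (y t).
have mdy := fe_space_derive1_measurable _ _ _ hs hy.
have mdv := fe_space_derive1_measurable _ _ _ hs hv.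
have mf := in_H1_measurable _ _ Hf.
have mFy := in_H1_measurable_comp _ _ F cF Hy.
pose r0 t := derive1 y t - F (y t) - f t.
have mr eps : coord_measurable T (r eps).
  apply: coord_measurableB mf; apply: coord_measurableB.
    by apply: (coord_measurableD _ _ _ mdy); exact: coord_measurableZ.
  have Hye := fe_space_in_H1 _ _ _ hs (fe_spaceD _ _ _ _ eps hy hv).
  exact: (in_H1_measurable_comp _ _ F cF Hye).
have mr0 : coord_measurable T r0.
  by apply: coord_measurableB mf; exact: coord_measurableB mdy mFy.
have mS : coord_measurable T S.
  apply: (coord_measurableB _ _ _ mdv) => i.
  rewrite (_ : (fun t => _) = (fun t => \sum_j v t ord0 j *
      ('D_(delta_mx ord0 j) F (y t)) ord0 i)); last first.
    apply/funext => t; rewrite derive_coordE; last exact: C2.1.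
    by rewrite summxE; apply: eq_bigr => j _; rewrite mxE.
  apply: measurable_sum => j; apply: measurable_funM.
    exact: in_H1_measurable Hv j.
  exact: (in_H1_measurable_comp _ _ (fun x => 'D_(delta_mx ord0 j) F x) (C1.2 _) Hy).
have [My My0 hMy] := fe_space_derive1_bounded _ _ _ hs hy.
have [Mv Mv0 hMv] := fe_space_derive1_bounded _ _ _ hs hv.
have [Mf Mf0 hMf] := in_H1_bounded _ _ T0 Hf.
have [My' My'0 hMy'] := in_H1_bounded _ _ T0 Hy.
have [Mv' Mv'0 hMv'] := in_H1_bounded _ _ T0 Hv.
(* A radius for which [y t + eps *: v t] stays in the ball whenever [|eps| <= 1]. *)
pose rho := My' + Mv'.
have [MF MF0 hMF] := bounded_continuous_ball _ rho cF.
have [MD MD0 hMD] := derive_bounded _ rho C1.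
have [K K0 hK] := taylor_ball _ rho C2.
have yrho t : t \in `]0, T[ -> enorm (y t) <= rho.
  by move=> /subset_itv_oo_cc/hMy'; rewrite /rho; lra.
have p1 : 0 <= MD * Mv' by exact: mulr_ge0.
have p2 : 0 <= K * Mv' ^+ 2 by rewrite mulr_ge0// sqr_ge0.
(* A single constant must bound the residual, its derivative in [eps] and the Taylor remainder,
   hence the sum of all the bounds. *)
apply: (first_variation T r r0 S _ _ (My + MF + Mf + Mv + MD * Mv' + K * Mv' ^+ 2)) => //.
- by rewrite !addr_ge0.
- move=> t tT; have tT' := subset_itv_oo_cc tT.
  have := enormD (derive1 y t - F (y t)) (- f t).
  have := enormD (derive1 y t) (- F (y t)); rewrite !enormN -/(r0 t).
  have := hMy t tT; have := hMF _ (yrho t tT); have := hMf _ tT'.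
  by lra.
- move=> t tT; have tT' := subset_itv_oo_cc tT.
  have := enormD (derive1 v t) (- 'D_(v t) F (y t)); rewrite enormN -/(S t).
  have h1 := hMv t tT; have h2 := hMD _ (v t) (yrho t tT).
  have h3 : MD * enorm (v t) <= MD * Mv' by rewrite ler_wpM2l// hMv'.
  by lra.
- move=> eps t eps1 tT; have tT' := subset_itv_oo_cc tT.
  have -> : r eps t - r0 t - eps *: S t =
      - (F (y t + eps *: v t) - F (y t) - 'D_(eps *: v t) F (y t)).
    rewrite /r0 /r /S.
    have -> : 'D_(eps *: v t) F (y t) = eps *: 'D_(v t) F (y t).
      by rewrite !deriveEjacobian ?scalemxAl//; exact: C2.1.
    by apply/rowP => i; rewrite !mxE; ring.
  rewrite enormN (le_trans (hK _ _ _ _))//; first exact: yrho.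
    rewrite (le_trans (enormD _ _))// lerD ?hMy'// enormZ.
    by rewrite (le_trans _ (hMv' t tT'))// ler_piMl ?enorm_ge0.
  rewrite enormZ exprMn real_normK ?num_real// mulrCA mulrC ler_wpM2r ?sqr_ge0//.
  have : K * enorm (v t) ^+ 2 <= K * Mv' ^+ 2.
    by rewrite ler_wpM2l// ler_pXn2r ?nnegrE ?enorm_ge0// hMv'.
  by lra.
move=> eps _.
have JE : J T F f g (fun t => y t + eps *: v t) =
    2^-1 * norm_L2 T (r eps) ^+ 2 + 2^-1 * enorm (y 0 - g + eps *: v 0) ^+ 2.
  have -> : y 0 - g + eps *: v 0 = y 0 + eps *: v 0 - g by rewrite addrAC.
  suff EL : norm_L2 T (fun t => derive1 (fun t => y t + eps *: v t) t
    - F (y t + eps *: v t) - f t) = norm_L2 T (r eps) by rewrite -EL.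
  apply: norm_L2_ae_eq (mr eps) _.
  have aeF := ae_filter_ringOfSetsType mu.
  apply: (@filterS _ _ aeF _ _ _ (fe_space_derive1D _ _ _ _ eps hs hy hv)).
  by move=> t h /h E; rewrite /r E.
by move: (miny _ (fe_spaceD _ _ _ _ eps hy hv)); rewrite JE; apply.
Qed.

End first_variation.

(** * Regularity of the auxiliary solution w *)

Section right_hand_side.
Context {R : realType} {d : nat}.
Implicit Types (T : R) (F : 'rV[R]_d -> 'rV[R]_d) (f y w : R -> 'rV[R]_d).
Notation mu := (@lebesgue_measure R).

Lemma acr_comp_add T F f y (rho K : R) i : 0 <= K ->
  abs_continuous T y -> abs_continuous T f ->
  (forall t, t \in `[0, T] -> enorm (y t) <= rho) ->
  (forall x x', enorm x <= rho -> enorm x' <= rho ->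
    enorm (F x - F x') <= K * enorm (x - x')) ->
  acr T (fun t => (F (y t) + f t) ord0 i).
Proof.
move=> K0 acy acf yr lipF e e0; have e2 : 0 < e / 2 by rewrite divr_gt0.
have K1 : 0 < K + 1 by rewrite ltr_wpDl.
have [dy dy0 hy] := acy _ (divr_gt0 e2 K1); have [df df0 hf] := acf _ e2.
exists (Num.min dy df); first by rewrite lt_min dy0.
move=> n a b ab tab; rewrite lt_min => /andP[sdy sdf].
have := hy n a b ab tab sdy; rewrite ltr_pdivlMr// mulr_suml => sy.
rewrite (splitr e) (le_lt_trans _ (ltrD sy (hf n a b ab tab sdf)))//.
rewrite -big_split ler_sum//= => k _.
have [a0 [abk bT]] := ab k.
have -> : (F (y (b k)) + f (b k)) ord0 i - (F (y (a k)) + f (a k)) ord0 i =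
    ((F (y (b k)) - F (y (a k))) + (f (b k) - f (a k))) ord0 i.
  by rewrite !mxE; ring.
rewrite (le_trans (abs_coord_le_enorm _ _))// (le_trans (enormD _ _))// lerD2r.
rewrite (le_trans (lipF _ _ _ _))//.
- by apply: yr; rewrite in_itv/= bT (le_trans a0).
- by apply: yr; rewrite in_itv/= a0 (le_trans abk).
- by rewrite mulrC ler_wpM2l ?enorm_ge0// lerDl.
Qed.

(* The derivative of [F (y t) + f t]; unlike [derive1] of that function, it is
   Borel measurable whenever [derive1 y] and [derive1 f] are. *)
Definition rhs_deriv F f y t := 'D_(derive1 y t) F (y t) + derive1 f t.

Lemma rhs_deriv_measurable T F f y : differentiable_C1 F ->
  in_H1 T y -> in_H1 T f -> coord_measurable T (rhs_deriv F f y).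
Proof.
move=> C1 Hy [_ _ [mdf _]]; have [_ _ [mdy _]] := Hy.
apply: coord_measurableD mdf => i.
rewrite (_ : (fun t => _) = (fun t => \sum_j derive1 y t ord0 j *
    ('D_(delta_mx ord0 j) F (y t)) ord0 i)); last first.
  apply/funext => t; rewrite derive_coordE; last exact: C1.1.
  by rewrite summxE; apply: eq_bigr => j _; rewrite mxE.
apply: measurable_sum => j; apply: measurable_funM; first exact: mdy.
exact: (in_H1_measurable_comp _ _ (fun x => 'D_(delta_mx ord0 j) F x) (C1.2 _) Hy).
Qed.

Lemma rhs_deriv_in_L2 T F f y : 0 < T -> differentiable_C1 F ->
  in_H1 T y -> in_H1 T f -> in_L2 T (rhs_deriv F f y).
Proof.
move=> T0 C1 Hy Hf; have mr := rhs_deriv_measurable _ _ _ _ C1 Hy Hf.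
split=> //.
have [_ _ /in_L2_integrable[_ i1]] := Hy.
have [_ _ /in_L2_integrable[_ i2]] := Hf.
have [rho rho0 yrho] := in_H1_bounded _ _ T0 Hy.
have [K K0 hK] := derive_bounded _ rho C1.
have aux (a b c : 'rV[R]_d) : enorm a <= K * enorm b ->
    `|enorm (a + c) ^+ 2| <= `|2 * K ^+ 2 * enorm b ^+ 2 + 2 * enorm c ^+ 2|.
  move=> hab; rewrite !ger0_norm ?sqr_ge0//; last first.
    by rewrite addr_ge0// mulr_ge0 ?sqr_ge0// mulr_ge0 ?sqr_ge0.
  have := enormD a c; have := enorm_ge0 (a + c); have := enorm_ge0 a.
  have := enorm_ge0 c; rewrite -mulrA -exprMn; set p := K * _ in hab *.
  set q := enorm c; set x := enorm (a + c); move=> q0 a0 x0 hx.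
  have h : x ^+ 2 <= (p + q) ^+ 2.
    by rewrite ler_pXn2r ?nnegrE//; lra.
  rewrite (le_trans h)//; have := sqr_ge0 (p - q).
  by rewrite sqrrB sqrrD; lra.
have : mu.-integrable `]0, T[ (EFin \o (fun t => enorm (rhs_deriv F f y t) ^+ 2)).
  have i1' : mu.-integrable `]0, T[
      (EFin \o (fun t => (2 * K ^+ 2) * enorm (derive1 y t) ^+ 2)).
    exact: (integrableZl _ (2 * K ^+ 2) i1).
  have i2' : mu.-integrable `]0, T[
      (EFin \o (fun t => 2 * enorm (derive1 f t) ^+ 2)).
    exact: (integrableZl _ 2 i2).
  apply: (le_integrable _ _ _ (integrableD _ i1' i2')) => //.
    by apply/measurable_EFinP; exact: measurable_sqr_enorm mr.
  move=> t tT /=; rewrite lee_fin.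
  exact: aux (hK _ _ (yrho t (subset_itv_oo_cc tT))).
move=> /integrableP[_]; apply: le_lt_trans; rewrite le_eqVlt; apply/orP; left.
by apply/eqP/eq_integral => t _ /=; rewrite ger0_norm ?sqr_ge0.
Qed.

Lemma rhs_is_derive T F f y : differentiable_C1 F -> in_H1 T y -> in_H1 T f ->
  {ae mu, forall t, t \in `]0, T[ ->
    derivable (fun t => F (y t) + f t) t 1 /\
    derive1 (fun t => F (y t) + f t) t = rhs_deriv F f y t}.
Proof.
move=> C1 [_ dy _] [_ df _]; have aeF := ae_filter_ringOfSetsType mu.
apply: (@filterS2 _ _ aeF _ _ _ _ dy df) => t hy hf tT.
have [dF DF] := is_derive_comp_curve F y t (C1.1 _) (hy tT).
split; first exact: derivableD dF (hf tT).
have := deriveD dF (hf tT); rewrite derive1E => E.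
by rewrite /rhs_deriv -DF !derive1E -E.
Qed.

(** [in_H1_FTC] would ask for measurability of [derive1] of the composed function; [acr_FTC] accepts
    the measurable representative [rhs_deriv]. *)
Lemma rhs_FTC T F f y i a b : 0 < T -> differentiable_C1 F ->
  in_H1 T y -> in_H1 T f -> 0 <= a -> a <= b -> b <= T ->
  (F (y b) + f b) ord0 i - (F (y a) + f a) ord0 i =
  \int[mu]_(t in `]a, b[) (rhs_deriv F f y t) ord0 i.
Proof.
move=> T0 C1 Hy Hf; have [rho rho0 yrho] := in_H1_bounded _ _ T0 Hy.
have [K K0 hK] := lipschitz_ball _ rho C1.
have Lr := rhs_deriv_in_L2 _ _ _ _ T0 C1 Hy Hf.
have [acy _ _] := Hy; have [acf _ _] := Hf.
have ac := acr_comp_add T F f y rho K i K0 acy acf yrho hK.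
apply: (acr_FTC _ _ (fun t => rhs_deriv F f y t ord0 i) T0 ac).
- exact: Lr.1 i.
- exact: in_L2_coord.
have aeF := ae_filter_ringOfSetsType mu.
apply: (@filterS _ _ aeF _ _ _ (rhs_is_derive _ _ _ _ C1 Hy Hf)) => t h /h[dG <-].
exact: is_derive_coord.
Qed.

Lemma rhs_continuous T F f y : continuous F -> in_H1 T y -> in_H1 T f ->
  {in `]0, T[%classic, continuous (fun t => F (y t) + f t)}.
Proof.
move=> cF Hy Hf t tT.
have cFy : {for t, continuous (F \o y)}.
  by apply: continuous_comp; [exact: in_H1_continuous Hy t tT|exact: cF].
exact: cvgD cFy (in_H1_continuous _ _ Hf t tT).
Qed.

(** The right-hand side is continuous, so [w], being its integral, satisfies the equation at every
    interior point by the classical fundamental theorem, and not only almost everywhere. *)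
Lemma strong_solution_derive1 T g F f y w : 0 < T -> continuous F ->
  in_H1 T y -> in_H1 T f ->
  strong_solution T g (fun t => F (y t) + f t) w ->
  forall t, t \in `]0, T[ ->
    derivable w t 1 /\ derive1 w t = F (y t) + f t.
Proof.
move=> T0 cF Hy Hf [Hw _ dw] t tT.
pose G t := F (y t) + f t.
have cG := rhs_continuous _ _ _ _ cF Hy Hf.
have mG : coord_measurable T G.
  apply: coord_measurableD; last exact: in_H1_measurable Hf.
  exact: in_H1_measurable_comp cF Hy.
have [_ _ Lw] := Hw.
(* The fundamental theorem at [t] is applied on an interval that reaches beyond [t]. *)
have [u tu uT] : exists2 u, t < u & u < T.
  move: tT; rewrite in_itv/= => /andP[_ tT].
  by exists ((t + T) / 2); [rewrite midf_lt//|rewrite midf_lt].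
have t0 : 0 < t by move: tT; rewrite in_itv/= => /andP[].
suff h i : is_derive t 1 (fun t => w t ord0 i) (G t ord0 i).
  have dwt : derivable w t 1.
    by apply/derivable_mxP => i j; rewrite (ord1 i); case: (h j).
  split=> //; apply/rowP => i.
  have [_ E] := is_derive_coord _ _ i dwt; rewrite -E.
  by case: (h i) => _ ->.
have aeG : ae_eq mu `]0, T[%classic
    (fun t => (derive1 w t ord0 i)%:E) (fun t => (G t ord0 i)%:E).
  have aeF := ae_filter_ringOfSetsType mu.
  by apply: (@filterS _ _ aeF _ _ _ dw) => x hx xT; rewrite (hx xT).
have iw := (in_L2_coord_integrable _ _ i Lw).1.
have mGi : measurable_fun `]0, T[ (fun t => (G t ord0 i)%:E).
  by apply/measurable_EFinP; exact: mG.
have iG : mu.-integrable `]0, T[ (EFin \o (fun t => G t ord0 i)).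
  apply/integrableP; split => //.
  have [_ h] := integrableP _ _ _ iw; apply: le_lt_trans h.
  rewrite le_eqVlt; apply/orP; left; apply/eqP/esym/ge0_ae_eq_integral => //.
  - by apply: measurableT_comp => //; exact: measurable_int iw.
  - exact: measurableT_comp.
  have aeF := ae_filter_ringOfSetsType mu.
  by apply: (@filterS _ _ aeF _ _ _ aeG) => x hx /hx[E]; rewrite /= E.
have wE x : 0 < x -> x < T -> w x ord0 i =
    w 0 ord0 i + \int[mu]_(s in `]0, x]) G s ord0 i.
  move=> x0 xT; apply/eqP; rewrite addrC -subr_eq; apply/eqP.
  rewrite (in_H1_FTC T)// ?ltW//.
  have sub : `]0, x[%classic `<=` `]0, T[%classic.
    by move=> z /=; rewrite !in_itv/= => /andP[-> /lt_trans]; exact.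
  rewrite -Rintegral_itv_bndo_bndc; last exact: integrableS iG.
  rewrite /Rintegral; congr fine; apply: ae_eq_integral => //.
  - by apply: measurable_funS (measurable_int _ iw).
  - by apply: measurable_funS mGi.
  have aeF := ae_filter_ringOfSetsType mu.
  by apply: (@filterS _ _ aeF _ _ _ aeG) => z hz /sub; exact: hz.
have iGu : mu.-integrable `]0, u] (EFin \o (fun t => G t ord0 i)).
  apply: integrableS iG => // z /=; rewrite !in_itv/= => /andP[-> zu].
  by rewrite (le_lt_trans zu).
have cGi : {for t, continuous (fun t => G t ord0 i)}.
  apply: (continuous_comp _ (@coord_continuous _ _ _ ord0 i _)).
  by apply: cG; rewrite inE.
have tu0 : (BRight 0 < BRight t)%O by rewrite bnd_simp.
have [dI DI] := @continuous_FTC1 _ (fun t => G t ord0 i) (BRight 0) t u tu iGu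
  tu0 cGi.
have E : \forall x \near t, w 0 ord0 i + \int[mu]_(s in `]0, x]) G s ord0 i = w x ord0 i.
  near=> x.
  have x0 : 0 < x by near: x; exact: lt_nbhsr.
  have xT : x < T by near: x; apply: lt_nbhsl; exact: lt_trans uT.
  exact/esym/wE.
apply: (near_eq_is_derive E).
rewrite -[X in is_derive _ _ _ X]add0r.
apply: is_deriveD.
by split; [exact: dI|rewrite -derive1E; exact: DI].
Unshelve. all: by end_near. Qed.

(** Differentiating [derive1 w] once more requires the equation in a whole neighbourhood of [t]; an
    almost everywhere identity would say nothing about [derive1] of [derive1 w]. *)
Lemma strong_solution_norm_derive2 T g F f y w : 0 < T ->
  differentiable_C1 F -> in_H1 T y -> in_H1 T f ->
  strong_solution T g (fun t => F (y t) + f t) w ->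
  norm_L2 T (derive1n 2 w) = norm_L2 T (rhs_deriv F f y).
Proof.
move=> T0 C1 Hy Hf Sw.
have cF : continuous F by move=> x; exact/differentiable_continuous/C1.1.
have dw := strong_solution_derive1 _ _ _ _ _ _ T0 cF Hy Hf Sw.
apply: norm_L2_ae_eq; first exact: rhs_deriv_measurable.
have aeF := ae_filter_ringOfSetsType mu.
apply: (@filterS _ _ aeF _ _ _ (rhs_is_derive _ _ _ _ C1 Hy Hf)) => t h tT.
have [_ <-] := h tT; rewrite /derive1n /= [LHS]derive1E [RHS]derive1E.
apply: near_eq_derive; near=> x; apply: (dw x _).2.
by near: x; exact: near_in_itvoo.
Unshelve. all: by end_near. Qed.

End right_hand_side.

(** Every subset of a countable set is Borel, whereas a subset of a null set need not be. *)
Lemma measurable_fun_off_countable {R : realType} (D N : set R) (f g : R -> R) :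
  measurable D -> countable N -> measurable_fun D g ->
  (forall t, D t -> ~ N t -> f t = g t) -> measurable_fun D f.
Proof.
move=> mD cN mg fg _ B mB.
have mcount (A : set R) : countable A -> measurable A.
  by move=> cA; exact: countable_measurable.
have -> : D `&` f @^-1` B =
    (D `&` f @^-1` B `&` N) `|` ((D `&` g @^-1` B) `\` N).
  apply/seteqP; split=> t /=.
    by move=> [Dt fB]; have [Nt|Nt] := pselect (N t); [left|right; rewrite -fg].
  by move=> [[]//|[[Dt gB] Nt]]; rewrite fg.
apply: measurableU.
  by apply: mcount; apply: sub_countable cN; apply: subset_card_le => t [].
by apply: measurableD; [exact: mg|exact: mcount].
Qed.

(** * The residual of the linear problem *)

Section finite_element_errors.
Context {R : realType} {d : nat}.
Implicit Types (T : R) (s : seq R) (u v : R -> 'rV[R]_d).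
Notation mu := (@lebesgue_measure R).

Lemma abs_continuousB T u v : abs_continuous T u -> abs_continuous T v ->
  abs_continuous T (u - v).
Proof.
move=> acu acv e e0; have e2 : 0 < e / 2 by rewrite divr_gt0.
have [du du0 hu] := acu _ e2; have [dv dv0 hv] := acv _ e2.
exists (Num.min du dv); first by rewrite lt_min du0.
move=> n a b ab tab; rewrite lt_min => /andP[sdu sdv].
rewrite (splitr e) (le_lt_trans _ (ltrD (hu n a b ab tab sdu)
  (hv n a b ab tab sdv)))//.
rewrite -big_split ler_sum//= => i _.
have -> : (u - v) (b i) - (u - v) (a i) =
    (u (b i) - u (a i)) + - (v (b i) - v (a i)).
  by apply/rowP => j; rewrite !mxE; ring.
by rewrite (le_trans (enormD _ _))// enormN.
Qed.

Lemma in_L2B T u v : in_L2 T u -> in_L2 T v -> in_L2 T (fun t => u t - v t).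
Proof.
move=> Lu Lv.
have mB : coord_measurable T (fun t => u t - v t).
  by apply: coord_measurableB; [exact: Lu.1|exact: Lv.1].
split=> //.
have [_ i1] := in_L2_integrable _ _ Lu; have [_ i2] := in_L2_integrable _ _ Lv.
have i1' : mu.-integrable `]0, T[ (EFin \o (fun t => 2 * enorm (u t) ^+ 2)).
  exact: (integrableZl _ 2 i1).
have i2' : mu.-integrable `]0, T[ (EFin \o (fun t => 2 * enorm (v t) ^+ 2)).
  exact: (integrableZl _ 2 i2).
have i3 : mu.-integrable `]0, T[
    (EFin \o (fun t => enorm (u t - v t) ^+ 2)).
  apply: (le_integrable _ _ _ (integrableD _ i1' i2')) => //.
    by apply/measurable_EFinP; exact: measurable_sqr_enorm mB.
  have aux (a b : 'rV[R]_d) :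
      `|enorm (a - b) ^+ 2| <= `|2 * enorm a ^+ 2 + 2 * enorm b ^+ 2|.
    rewrite !ger0_norm ?sqr_ge0//; last first.
      by rewrite addr_ge0// mulr_ge0 ?sqr_ge0.
    have := dotxx_ge0 (a + b).
    by rewrite !sqr_enorm !(dotBl, dotBr, dotDl, dotDr); lra.
  by move=> t _ /=; rewrite lee_fin; exact: aux.
move: i3 => /integrableP[_]; apply: le_lt_trans; rewrite le_eqVlt.
apply/orP; left; apply/eqP/eq_integral => t _ /=.
by rewrite ger0_norm ?sqr_ge0.
Qed.

(** Integrates a pointwise inequality and stands in for the triangle inequality of L^2. *)
Lemma sqr_norm_L2_le T u v : in_L2 T u -> in_L2 T v ->
  norm_L2 T u ^+ 2 <= 2 * norm_L2 T v ^+ 2 + 2 * norm_L2 T (fun t => u t - v t) ^+ 2.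
Proof.
move=> Lu Lv; rewrite !sqr_norm_L2.
have [_ i1] := in_L2_integrable _ _ Lu; have [_ i2] := in_L2_integrable _ _ Lv.
have [_ i3] := in_L2_integrable _ _ (in_L2B _ _ _ Lu Lv).
have i2' : mu.-integrable `]0, T[ (EFin \o (fun t => 2 * enorm (v t) ^+ 2)).
  exact: (integrableZl _ 2 i2).
have i3' : mu.-integrable `]0, T[ (EFin \o (fun t => 2 * enorm (u t - v t) ^+ 2)).
  exact: (integrableZl _ 2 i3).
rewrite -!RintegralZl// -RintegralD//; apply: le_Rintegral => //.
  exact: (integrableD _ i2' i3').
move=> t _; have := dotxx_ge0 (u t - v t - v t).
by rewrite !sqr_enorm !(dotBl, dotBr) !(dotC (v t) (u t)); lra.
Qed.

(* The set where [derive1 (u - v)] is not the difference of the derivatives must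
   be countable, not just null, for the derivative to be Borel measurable. *)
Lemma in_H1B T u v (N : set R) : countable N -> in_H1 T u -> in_H1 T v ->
  (forall t, t \in `]0, T[ -> ~ N t -> derivable u t 1 /\ derivable v t 1) ->
  in_H1 T (u - v) /\
  norm_L2 T (derive1 (u - v)) = norm_L2 T (fun t => derive1 u t - derive1 v t).
Proof.
move=> cN [acu _ Lu] [acv _ Lv] hN.
have mcN : measurable N by exact: countable_measurable.
have muN : mu N = 0%E by exact: countable_lebesgue_measure0.
have Duv t : t \in `]0, T[ -> ~ N t ->
    derive1 (u - v) t = derive1 u t - derive1 v t.
  move=> tT /(hN t tT)[du dv].
  rewrite (derive1E (u - v)) (derive1E u) (derive1E v).
  exact: deriveB du dv.
have mB : coord_measurable T (fun t => derive1 u t - derive1 v t).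
  by apply: coord_measurableB; [exact: Lu.1|exact: Lv.1].
have mD : coord_measurable T (derive1 (u - v)).
  move=> i; apply: (measurable_fun_off_countable _ N _ _ _ cN (mB i)) => //.
  by move=> t tT Nt; rewrite (Duv _ tT Nt).
have aeD : {ae mu, forall t, t \in `]0, T[ ->
    derive1 (u - v) t = derive1 u t - derive1 v t}.
  exists N; split=> // t /= /not_implyP[tT ne].
  by apply: contrapT => Nt; exact: ne (Duv _ tT Nt).
split; last exact: norm_L2_ae_eq mB aeD.
split.
- exact: abs_continuousB.
- exists N; split=> // t /= /not_implyP[tT ne].
  apply: contrapT => Nt; apply: ne.
  by have [du dv] := hN _ tT Nt; exact: derivableB.
split=> //.
have E : (\int[mu]_(t in `]0%R, T[) (enorm (derive1 (u - v) t) ^+ 2)%:E)%E =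
    (\int[mu]_(t in `]0%R, T[) (enorm (derive1 u t - derive1 v t) ^+ 2)%:E)%E.
  have H := @ge0_integral_eq_off_null _ _ R (@lebesgue_measure R) `]0, T[ N
    (fun t => (enorm (derive1 (u - v) t) ^+ 2)%:E)
    (fun t => (enorm (derive1 u t - derive1 v t) ^+ 2)%:E).
  apply: H => //.
  - by apply/measurable_EFinP; exact: measurable_sqr_enorm mB.
  - by move=> t _; rewrite lee_fin sqr_ge0.
  - by move=> t _; rewrite lee_fin sqr_ge0.
  - by move=> t tT Nt; rewrite Duv.
by rewrite E; exact: (in_L2B _ _ _ Lu Lv).2.
Qed.

Lemma coord_measurable_cst T (c : 'rV[R]_d) : coord_measurable T (fun=> c).
Proof. by move=> i; exact: measurable_cst. Qed.

Lemma ramp_derive1 T s k i (c : 'rV[R]_d) t : itv_partition 0 T s -> (k < size s)%N ->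
  (i < size s)%N -> t \in `]node s i, node s i.+1[ ->
  derive1 (ramp (node s k) (node s k.+1) c) t = if i == k then c else 0.
Proof.
move=> hs ks is_ ti; have kk := ltW (node_lt _ _ _ hs ks).
have hr := fe_space_ramp T s k c hs ks.
have [_ ->] := fe_space_derive1 _ _ _ _ _ hs hr is_ ti; rewrite /slope /ramp.
have ii := node_lt _ _ _ hs is_.
have [ik|ki|->] := ltngtP i k.
- have h : node s i.+1 <= node s k by rewrite (node_le _ _ _ _ hs)// ltnW.
  rewrite (max_r h) (max_r (le_trans (ltW ii) h)) (min_l kk).
  by rewrite subrr scaler0.
- have h : node s k.+1 <= node s i by rewrite (node_le _ _ _ _ hs)// ltnW.
  rewrite !max_l ?(le_trans kk)// ?(le_trans h (ltW ii))//.
  by rewrite !min_r ?(le_trans h (ltW ii))// subrr scaler0.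
- rewrite (max_l kk) max_r// (min_l kk) min_l// subrr scale0r subr0.
  by rewrite scalerA mulVf ?scale1r// subr_eq0 gt_eqF// (node_lt _ _ _ hs).
Qed.

(** As [rho] has mean zero, [rho t * (b - a)] is the integral over [x] of [rho t - rho x], whose
    integrand is at most [m] in absolute value. *)
Lemma Rintegral_mean0_bound (a b m : R) (rho : R -> R) : a < b ->
  mu.-integrable `]a, b[ (EFin \o rho) -> \int[mu]_(t in `]a, b[) rho t = 0 ->
  (forall x y, x \in `]a, b[ -> y \in `]a, b[ -> x <= y -> `|rho y - rho x| <= m) ->
  forall t, t \in `]a, b[ -> `|rho t| <= m.
Proof.
move=> ab irho rho0 osc t tab.
have ic c : mu.-integrable `]a, b[ (EFin \o (cst c : R -> R)).
  by apply: (@measurable_bounded_integrable_oo _ _ _ `|c|).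
have Icst c : \int[mu]_(x in `]a, b[) c = c * (b - a).
  rewrite Rintegral_cst//; congr (_ * _).
  apply: (@eq_trans _ _ (fine (mu `]a, b[))); first by [].
  by rewrite lebesgue_measure_oo// ltW.
have E : \int[mu]_(x in `]a, b[) (rho t - rho x) = rho t * (b - a).
  by rewrite (RintegralB _ (ic (rho t)) irho)// rho0 subr0 Icst.
have iB : mu.-integrable `]a, b[ (EFin \o (fun x => rho t - rho x)).
  exact: (integrableB _ (ic (rho t)) irho).
have ba : 0 < b - a by rewrite subr_gt0.
rewrite -(ler_pM2r ba) -[X in _ * X <= _](gtr0_norm ba) -normrM -E -Icst.
apply: (le_trans (le_normr_Rintegral _ iB)) => //.
apply: le_Rintegral => //.
- exact: integrable_norm.
- exact: ic.
move=> x xab; have [xt|/ltW tx] := leP x t; first exact: osc.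
by rewrite distrC; exact: osc.
Qed.

(** For [w = z] this is the residual of the nonlinear equation. *)
Definition residual (F : 'rV[R]_d -> 'rV[R]_d) f (z w : R -> 'rV[R]_d) (t : R) :=
  derive1 w t - F (z t) - f t.

Lemma residual_measurable T s F f z w : itv_partition 0 T s -> continuous F ->
  in_H1 T f -> in_H1 T z -> fe_space d T s w ->
  coord_measurable T (residual F f z w).
Proof.
move=> hs cF Hf Hz hw.
apply: coord_measurableB (in_H1_measurable _ _ Hf).
apply: coord_measurableB (fe_space_derive1_measurable _ _ _ hs hw) _.
exact: in_H1_measurable_comp cF Hz.
Qed.

Lemma residual_bounded T s F f z w : 0 < T -> itv_partition 0 T s ->
  continuous F -> in_H1 T f -> in_H1 T z -> fe_space d T s w ->
  exists2 M : R, 0 <= M &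
    forall t, t \in `]0, T[ -> enorm (residual F f z w t) <= M.
Proof.
move=> T0 hs cF Hf Hz hw.
have [Mw Mw0 hMw] := fe_space_derive1_bounded _ _ _ hs hw.
have [Mf Mf0 hMf] := in_H1_bounded _ _ T0 Hf.
have [Mz Mz0 hMz] := in_H1_bounded _ _ T0 Hz.
have [MF MF0 hMF] := bounded_continuous_ball _ Mz cF.
exists (Mw + MF + Mf); first by rewrite !addr_ge0.
have aux (a b c : 'rV[R]_d) : enorm a <= Mw -> enorm b <= MF -> enorm c <= Mf ->
    enorm (a - b - c) <= Mw + MF + Mf.
  move=> ha hb hc; rewrite (le_trans (enormD _ _))// enormN lerD//.
  by rewrite (le_trans (enormD _ _))// enormN lerD.
move=> t tT; have tT' := subset_itv_oo_cc tT.
exact: aux (hMw t tT) (hMF _ (hMz _ tT')) (hMf _ tT').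
Qed.

Lemma residual_mean0 T s F f g z w k c : 0 < T -> itv_partition 0 T s ->
  continuous F -> in_H1 T f -> in_H1 T z ->
  minimizer_on (fe_space d T s) (J_lin T F f g z) w -> (k < size s)%N ->
  \int[mu]_(t in `]node s k, node s k.+1[) dot (residual F f z w t) c = 0.
Proof.
move=> T0 hs cF Hf Hz minw ks.
have hw := minw.1; have hr := fe_space_ramp T s k c hs ks.
have E := J_lin_first_variation _ _ _ _ _ _ _ _ T0 hs cF Hf Hz minw hr.
(* The ramp vanishes at 0, so the boundary term of the first-order condition drops out. *)
rewrite ramp0 ?(node_ge0 _ _ _ hs) ?(ltnW ks)// in E; last first.
  exact: ltW (node_lt _ _ _ hs ks).
rewrite [dot _ 0]dotC dot0l addr0 in E.
have [M M0 hM] := residual_bounded _ _ _ _ _ _ T0 hs cF Hf Hz hw.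
have mr := residual_measurable _ _ _ _ _ _ hs cF Hf Hz hw.
have mdr := fe_space_derive1_measurable _ _ _ hs hr.
have [N N0 hN] := fe_space_derive1_bounded _ _ _ hs hr.
have ir := integrable_dot_bounded _ _ _ _ _ mr mdr hM hN.
have := Rintegral_node_split T s _ hs ir; rewrite E (bigD1 (Ordinal ks))//=.
rewrite big1 ?addr0 => [H|i ik].
  rewrite [RHS]H; apply: eq_Rintegral => t; rewrite inE/= => tk.
  by rewrite (ramp_derive1 T _ _ _ _ _ hs ks ks tk) eqxx.
rewrite (_ : \int[mu]_(t in _) _ =
  \int[mu]_(t in `]node s i, node s i.+1[) 0); last first.
  apply: eq_Rintegral => t; rewrite inE/= => ti.
  rewrite (ramp_derive1 T _ _ _ _ _ hs ks (ltn_ord i) ti).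
  by rewrite -val_eqE/= in ik; rewrite (negPf ik) dotC dot0l.
by rewrite Rintegral_cst// mul0r.
Qed.

(* On each element the residual is a constant minus [F (z t) + f t] and has mean
   zero, so its size is bounded by the oscillation of [F (z t) + f t]. *)
Lemma residual_pointwise T s F f g z w k j t : 0 < T -> itv_partition 0 T s ->
  differentiable_C1 F -> in_H1 T f -> in_H1 T z ->
  minimizer_on (fe_space d T s) (J_lin T F f g z) w -> (k < size s)%N ->
  t \in `]node s k, node s k.+1[ ->
  `|residual F f z w t ord0 j| <= Num.sqrt (node s k.+1 - node s k) *
    Num.sqrt (\int[mu]_(t in `]node s k, node s k.+1[) enorm (rhs_deriv F f z t) ^+ 2).
Proof.
move=> T0 hs C1 Hf Hz minw ks.
have cF : continuous F by move=> x; exact/differentiable_continuous/C1.1.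
have hw := minw.1; have kk := node_lt _ _ _ hs ks.
have n0 := node_ge0 _ _ _ hs (ltnW ks); have nT := node_leT _ _ _ hs ks.
have [M M0 hM] := residual_bounded _ _ _ _ _ _ T0 hs cF Hf Hz hw.
have mr := residual_measurable _ _ _ _ _ _ hs cF Hf Hz hw.
have Lr := rhs_deriv_in_L2 _ _ _ _ T0 C1 Hz Hf.
apply: (Rintegral_mean0_bound _ _ _ (fun t => residual F f z w t ord0 j) kk).
- apply: (integrable_subset_oo T) => //.
  apply: (@measurable_bounded_integrable_oo _ _ _ M); first exact: mr.
  by move=> x xT; rewrite (le_trans (abs_coord_le_enorm _ _))// hM.
- rewrite -[RHS](residual_mean0 T s F f g z w k (delta_mx ord0 j) T0 hs cF Hf Hz minw ks).
  apply: eq_Rintegral => x _; rewrite /dot (bigD1 j)//= big1 ?addr0.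
    by rewrite !mxE !eqxx mulr1.
  by move=> i /negPf ij; rewrite !mxE ij andbF mulr0.
move=> x y xk yk xy.
have [_ Dx] := fe_space_derive1 _ _ _ _ _ hs hw ks xk.
have [_ Dy] := fe_space_derive1 _ _ _ _ _ hs hw ks yk.
have -> : residual F f z w y ord0 j - residual F f z w x ord0 j =
    - ((F (z y) + f y) ord0 j - (F (z x) + f x) ord0 j).
  by rewrite /residual Dx Dy !mxE; ring.
move: xk yk; rewrite !in_itv/= => /andP[kx _] /andP[_ yk].
have x0 := le_trans n0 (ltW kx); have yT := le_trans (ltW yk) nT.
rewrite normrN (rhs_FTC T F f z)//.
have [i1 i2] := in_L2_coord_integrable _ _ j Lr.
rewrite (le_trans (Rintegral_cauchy_schwarz_oo T _ _ _ _ _ _ i1 i2))//.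
rewrite ler_pM ?sqrtr_ge0// ler_wsqrtr//.
  by rewrite lerD ?lerN2 ?ltW.
by apply: Rintegral_sqr_coord_le Lr _ _ _ _ => //; exact: ltW.
Qed.

(** The vector [c] is free because the residual is orthogonal to constants on the element. The
    factor [d] comes from summing the coordinatewise bound on the residual. *)
Lemma residual_pairing T s F f g z w k (phi : R -> 'rV[R]_d) (c : 'rV[R]_d)
    (B M : R) : 0 < T -> itv_partition 0 T s ->
  differentiable_C1 F -> in_H1 T f -> in_H1 T z ->
  minimizer_on (fe_space d T s) (J_lin T F f g z) w -> (k < size s)%N ->
  coord_measurable T phi ->
  (forall t, t \in `]0, T[ -> enorm (phi t) <= M) -> 0 <= B ->
  (forall t, t \in `]node s k, node s k.+1[ -> enorm (phi t - c) <= B) ->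
  `|\int[mu]_(t in `]node s k, node s k.+1[) dot (residual F f z w t) (phi t)| <=
  (node s k.+1 - node s k) * (d%:R * (Num.sqrt (node s k.+1 - node s k) *
    Num.sqrt (\int[mu]_(t in `]node s k, node s k.+1[)
      enorm (rhs_deriv F f z t) ^+ 2)) * B).
Proof.
move=> T0 hs C1 Hf Hz minw ks mphi hphi B0 hB.
have cF : continuous F by move=> x; exact/differentiable_continuous/C1.1.
have hw := minw.1; have kk := node_lt _ _ _ hs ks.
have n0 := node_ge0 _ _ _ hs (ltnW ks); have nT := node_leT _ _ _ hs ks.
have [N N0 hN] := residual_bounded _ _ _ _ _ _ T0 hs cF Hf Hz hw.
have mr := residual_measurable _ _ _ _ _ _ hs cF Hf Hz hw.
have hphic t : t \in `]0, T[ -> enorm (phi t - c) <= M + enorm c.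
  move=> tT; rewrite (le_trans (enormD _ _))// enormN lerD2r; exact: hphi.
have mphic : coord_measurable T (fun t => phi t - c).
  by apply: coord_measurableB mphi _; exact: coord_measurable_cst.
have ic : mu.-integrable `]node s k, node s k.+1[
    (EFin \o (fun t => dot (residual F f z w t) c)).
  apply: (integrable_subset_oo T) => //.
  by apply: (integrable_dot_bounded _ _ (fun=> c) _ (enorm c) mr _ hN) => //;
    exact: coord_measurable_cst.
have ipc : mu.-integrable `]node s k, node s k.+1[
    (EFin \o (fun t => dot (residual F f z w t) (phi t - c))).
  apply: (integrable_subset_oo T) => //.
  exact: (integrable_dot_bounded _ _ _ _ _ mr mphic hN hphic).
have -> : \int[mu]_(t in `]node s k, node s k.+1[) dot (residual F f z w t) (phi t) =
    \int[mu]_(t in `]node s k, node s k.+1[) dot (residual F f z w t) (phi t - c).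
  rewrite -[RHS]addr0 -(residual_mean0 T s F f g z w k c T0 hs cF Hf Hz minw ks).
  rewrite -RintegralD//; apply: eq_Rintegral => t _.
  by rewrite -dotDr subrK.
set m := d%:R * _.
have m0 : 0 <= m by rewrite /m !mulr_ge0 ?sqrtr_ge0.
apply: (le_trans (le_normr_Rintegral _ ipc)) => //.
apply: (@le_trans _ _ (\int[mu]_(t in `]node s k, node s k.+1[) (m * B))).
  apply: le_Rintegral => //.
  - exact: integrable_norm.
  - by apply: (@measurable_bounded_integrable_oo _ _ _ `|m * B|).
  move=> t tk; rewrite (le_trans (abs_dot_le _ _))// ler_pM ?enorm_ge0//; last exact: hB.
  rewrite (le_trans (enorm_le_sum _))//.
  rewrite /m -[X in X%:R]card_ord -sum1_card natr_sum mulr_suml ler_sum// => j _.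
  by rewrite mul1r; exact: residual_pointwise minw ks tk.
rewrite Rintegral_cst// mulrC le_eqVlt; apply/orP; left; apply/eqP; congr (_ * _).
apply: (@eq_trans _ _ (fine (mu `]node s k, node s k.+1[))); first by [].
by rewrite lebesgue_measure_oo// ltW.
Qed.

End finite_element_errors.

Lemma sumr_affine_comb {R : realType} (I : finType) (a b c : R) (p q : I -> R) :
  \sum_k c * (a * p k + b * q k) = c * (a * (\sum_k p k) + b * (\sum_k q k)).
Proof. by rewrite -mulr_sumr big_split/= -!mulr_sumr. Qed.

Lemma ler_affine_comb {R : realType} (a b c p q v x y : R) :
  0 <= a -> 0 <= b -> 0 <= c -> p <= v * x -> q <= v * y ->
  a * (b * p + c * q) <= a * v * (b * x + c * y).
Proof.
move=> a0 b0 c0 pv qv; rewrite -[leRHS]mulrA ler_wpM2l// mulrDr.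
by rewrite lerD// mulrCA ler_wpM2l.
Qed.

(** * The discrete error *)

Section discrete_error.
Context {R : realType} {d : nat}.
Implicit Types (T : R) (s : seq R) (F : 'rV[R]_d -> 'rV[R]_d).
Implicit Types (f y u v w : R -> 'rV[R]_d).
Notation mu := (@lebesgue_measure R).

Lemma Rintegral_ae_eq_bounded T (p q : R -> R) :
  mu.-integrable `]0, T[ (EFin \o p) -> mu.-integrable `]0, T[ (EFin \o q) ->
  {ae mu, forall t, t \in `]0, T[ -> p t = q t} ->
  \int[mu]_(t in `]0, T[) p t = \int[mu]_(t in `]0, T[) q t.
Proof.
move=> ip iq pq; rewrite /Rintegral; congr fine; apply: ae_eq_integral => //.
- exact: measurable_int ip.
- exact: measurable_int iq.
have aeF := ae_filter_ringOfSetsType mu.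
by apply: (@filterS _ _ aeF _ _ _ pq) => t h tT; rewrite h.
Qed.

Definition linearization F y u t := 'D_(u t) F (y t).

Lemma linearization_measurable T F y u : differentiable_C1 F ->
  in_H1 T y -> in_H1 T u -> coord_measurable T (linearization F y u).
Proof.
move=> C1 Hy Hu i.
rewrite (_ : (fun t => _) = (fun t => \sum_j u t ord0 j *
    ('D_(delta_mx ord0 j) F (y t)) ord0 i)); last first.
  apply/funext => t; rewrite /linearization derive_coordE; last exact: C1.1.
  by rewrite summxE; apply: eq_bigr => j _; rewrite mxE.
apply: measurable_sum => j; apply: measurable_funM.
  exact: in_H1_measurable Hu j.
exact: (in_H1_measurable_comp _ _ (fun x => 'D_(delta_mx ord0 j) F x) (C1.2 _) Hy).
Qed.

(** Insert [ry = rw + de] in the nonlinear condition and subtract the linear one. [A] and [B] are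
    the boundary terms at time 0, whose difference completes the left-hand side to the square of the
    X norm; [M] provides integrability. *)
Lemma energy_balance T (ry rw de phi : R -> 'rV[R]_d) (A B M : R) :
  coord_measurable T ry -> coord_measurable T rw ->
  coord_measurable T de -> coord_measurable T phi ->
  (forall t, t \in `]0, T[ -> [/\ enorm (ry t) <= M, enorm (rw t) <= M,
    enorm (de t) <= M & enorm (phi t) <= M]) ->
  {ae mu, forall t, t \in `]0, T[ -> ry t = rw t + de t} ->
  \int[mu]_(t in `]0, T[) dot (ry t) (de t - phi t) + A = 0 ->
  \int[mu]_(t in `]0, T[) dot (rw t) (de t) + B = 0 ->
  \int[mu]_(t in `]0, T[) dot (de t) (de t) + (A - B) =
  \int[mu]_(t in `]0, T[) dot (de t) (phi t) +
  \int[mu]_(t in `]0, T[) dot (rw t) (phi t).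
Proof.
move=> mr mw me mphi hM resE Ey Ew.
have hMr t : t \in `]0, T[ -> enorm (ry t) <= M by move/hM => [].
have hMw t : t \in `]0, T[ -> enorm (rw t) <= M by move/hM => [].
have hMe t : t \in `]0, T[ -> enorm (de t) <= M by move/hM => [].
have hphi t : t \in `]0, T[ -> enorm (phi t) <= M by move/hM => [].
have iee := integrable_dot_bounded _ _ _ _ _ me me hMe hMe.
have iephi := integrable_dot_bounded _ _ _ _ _ me mphi hMe hphi.
have iwphi := integrable_dot_bounded _ _ _ _ _ mw mphi hMw hphi.
have iwe := integrable_dot_bounded _ _ _ _ _ mw me hMw hMe.
have ire := integrable_dot_bounded _ _ _ _ _ mr me hMr hMe.
have irphi := integrable_dot_bounded _ _ _ _ _ mr mphi hMr hphi.
have aeF := ae_filter_ringOfSetsType mu.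
have mD : measurable (`]0, T[%classic : set R) by exact: measurable_itv.
have E1 : \int[mu]_(t in `]0, T[) dot (ry t) (de t) =
    \int[mu]_(t in `]0, T[) dot (rw t) (de t) +
    \int[mu]_(t in `]0, T[) dot (de t) (de t).
  rewrite -RintegralD//; apply: Rintegral_ae_eq_bounded => //.
    exact: (integrableD _ iwe iee).
  by apply: (@filterS _ _ aeF _ _ _ resE) => t h /h ->; rewrite dotDl.
have E2 : \int[mu]_(t in `]0, T[) dot (ry t) (phi t) =
    \int[mu]_(t in `]0, T[) dot (rw t) (phi t) +
    \int[mu]_(t in `]0, T[) dot (de t) (phi t).
  rewrite -RintegralD//; apply: Rintegral_ae_eq_bounded => //.
    exact: (integrableD _ iwphi iephi).
  by apply: (@filterS _ _ aeF _ _ _ resE) => t h /h ->; rewrite dotDl.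
have E3 : \int[mu]_(t in `]0, T[) dot (ry t) (de t - phi t) =
    \int[mu]_(t in `]0, T[) dot (ry t) (de t) -
    \int[mu]_(t in `]0, T[) dot (ry t) (phi t).
  by rewrite -RintegralB//; apply: eq_Rintegral => t _; rewrite dotBr.
rewrite E3 E1 E2 in Ey; lra.
Qed.

Lemma energy_identity T s F f g y w : 0 < T -> itv_partition 0 T s ->
  differentiable_C2 F -> in_H1 T f ->
  minimizer_on (fe_space d T s) (J T F f g) y ->
  minimizer_on (fe_space d T s) (J_lin T F f g y) w ->
  norm_X T (y - w) ^+ 2 =
  \int[mu]_(t in `]0, T[) dot (derive1 (y - w) t) (linearization F y (y - w) t) +
  \int[mu]_(t in `]0, T[) dot (residual F f y w t) (linearization F y (y - w) t).
Proof.
move=> T0 hs C2 Hf miny minw.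
have C1 := differentiable_C2W _ C2.
have cF : continuous F by move=> x; exact/differentiable_continuous/C2.1.
have hy := miny.1; have hw := minw.1.
have he : fe_space d T s (y - w) by exact: fe_spaceB hy hw.
have Hy := fe_space_in_H1 _ _ _ hs hy; have He := fe_space_in_H1 _ _ _ hs he.
have Ey := J_first_variation _ _ _ _ _ _ _ T0 hs C2 Hf miny he.
have Ew := J_lin_first_variation _ _ _ _ _ _ _ _ T0 hs cF Hf Hy minw he.
have [Mr Mr0 hMr] := residual_bounded _ _ _ _ _ _ T0 hs cF Hf Hy hy.
have [Mw Mw0 hMw] := residual_bounded _ _ _ _ _ _ T0 hs cF Hf Hy hw.
have [Me Me0 hMe] := fe_space_derive1_bounded _ _ _ hs he.
have [E E0 hE] := in_H1_bounded _ _ T0 He.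
have [rho rho0 yrho] := in_H1_bounded _ _ T0 Hy.
have [K K0 hK] := derive_bounded _ rho C1.
have mr := residual_measurable _ _ _ _ _ _ hs cF Hf Hy hy.
have mw := residual_measurable _ _ _ _ _ _ hs cF Hf Hy hw.
have me := fe_space_derive1_measurable _ _ _ hs he.
have mphi := linearization_measurable _ _ _ _ C1 Hy He.
have hphi t : t \in `]0, T[ -> enorm (linearization F y (y - w) t) <= K * E.
  move=> /subset_itv_oo_cc tT; rewrite (le_trans (hK _ _ (yrho t tT)))//.
  by rewrite ler_wpM2l// hE.
have aeF := ae_filter_ringOfSetsType mu.
have resE : {ae mu, forall t, t \in `]0, T[ ->
    residual F f y y t = residual F f y w t + derive1 (y - w) t}.
  apply: (@filterS2 _ _ aeF _ _ _ _ (fe_space_derivable _ _ _ hs hy)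
    (fe_space_derivable _ _ _ hs hw)) => t dy dw tT.
  have -> : derive1 (y - w) t = derive1 y t - derive1 w t.
    rewrite (derive1E (y - w)) (derive1E y) (derive1E w).
    exact: deriveB (dy tT) (dw tT).
  by apply/rowP => i; rewrite !mxE; ring.
pose M := Mr + Mw + Me + K * E.
have hM t : t \in `]0, T[ -> [/\ enorm (residual F f y y t) <= M,
    enorm (residual F f y w t) <= M, enorm (derive1 (y - w) t) <= M &
    enorm (linearization F y (y - w) t) <= M].
  move=> tT; have KE : 0 <= K * E by exact: mulr_ge0.
  split; [apply: le_trans (hMr t tT) _|apply: le_trans (hMw t tT) _|
    apply: le_trans (hMe t tT) _|apply: le_trans (hphi t tT) _];
    rewrite /M; lra.
have E4 : norm_X T (y - w) ^+ 2 =
    \int[mu]_(t in `]0, T[) dot (derive1 (y - w) t) (derive1 (y - w) t) +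
    dot ((y - w) 0) ((y - w) 0).
  by rewrite /norm_X sqr_sqrtr ?dot_X_ge0.
(* The datum [g] cancels in the difference of the two boundary terms. *)
have E5 : dot ((y - w) 0) ((y - w) 0) = dot (y 0 - g) ((y - w) 0) -
    dot (w 0 - g) ((y - w) 0).
  by rewrite -dotBl; congr dot; apply/rowP => i; rewrite !mxE; ring.
rewrite E4 E5.
exact: energy_balance mr mw me mphi hM resE Ey Ew.
Qed.

Lemma linearization_L2_le T F y u (L : R) : 0 < T ->
  differentiable_C1 F -> in_H1 T y -> in_H1 T u -> 0 <= L ->
  (forall t, t \in `]0, T[ -> enorm (linearization F y u t) <= L * enorm (u t)) ->
  (exists M : R, forall t, t \in `]0, T[ -> enorm (derive1 u t) <= M) ->
  \int[mu]_(t in `]0, T[) dot (derive1 u t) (linearization F y u t) <=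
  const_L2 d T * L * norm_X T u ^+ 2.
Proof.
move=> T0 C1 Hy Hu L0 hL [M hM].
have [_ _ Lu] := Hu; have mdu := Lu.1; have mu_ := in_H1_measurable _ _ Hu.
have [E E0 hE] := in_H1_bounded _ _ T0 Hu.
have hE' t : t \in `]0, T[ -> enorm (u t) <= E by move/subset_itv_oo_cc/hE.
have mphi := linearization_measurable _ _ _ _ C1 Hy Hu.
have hphi t : t \in `]0, T[ -> enorm (linearization F y u t) <= L * E.
  by move=> tT; rewrite (le_trans (hL t tT))// ler_wpM2l// hE'.
have i1 := integrable_dot_bounded _ _ _ _ _ mdu mphi hM hphi.
have i2 := integrable_sqr_bounded _ _ _ mdu hM.
have i3 := integrable_sqr_bounded _ _ _ mu_ hE'.
have i4 : mu.-integrable `]0, T[ (EFin \o (fun t => enorm (derive1 u t) * enorm (u t))).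
  apply: (@measurable_bounded_integrable_oo _ _ _ (M * E)).
    apply: measurable_funM; first exact: (measurable_enorm _ _ mdu).
    exact: (measurable_enorm _ _ mu_).
  move=> t tT; rewrite ger0_norm ?mulr_ge0 ?enorm_ge0//.
  by rewrite ler_pM ?enorm_ge0// ?hM// hE'.
apply: (@le_trans _ _
  (\int[mu]_(t in `]0, T[) (L * (enorm (derive1 u t) * enorm (u t))))).
  apply: le_Rintegral => //; first exact: (integrableZl _ L i4).
  move=> t tT; rewrite (le_trans (ler_norm _))// (le_trans (abs_dot_le _ _))//.
  by rewrite mulrCA ler_wpM2l ?enorm_ge0// hL.
rewrite RintegralZl// [const_L2 d T * L]mulrC -mulrA ler_wpM2l//.
rewrite (le_trans (ler_norm _))//.
rewrite (le_trans (Rintegral_cauchy_schwarz _ _ _ _ i2 i3 i4))//.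
rewrite expr2 mulrCA ler_pM ?sqrtr_ge0//; first exact: norm_L2_derive1_le.
exact: norm_L2_le_const_L2.
Qed.

Lemma residual_linearization_le T s F f g y w u (L K E : R) : 0 < T ->
  itv_partition 0 T s -> differentiable_C1 F -> in_H1 T f ->
  fe_space d T s y -> fe_space d T s u ->
  minimizer_on (fe_space d T s) (J_lin T F f g y) w ->
  0 <= L -> 0 <= K -> 0 <= E ->
  (forall t, t \in `[0, T] -> enorm (u t) <= E) ->
  (forall t (v : 'rV[R]_d), t \in `[0, T] ->
    enorm ('D_v F (y t)) <= L * enorm v) ->
  (forall t t' (v : 'rV[R]_d), t \in `[0, T] -> t' \in `[0, T] ->
    enorm ('D_v F (y t) - 'D_v F (y t')) <= K * enorm v * enorm (y t - y t')) ->
  \int[mu]_(t in `]0, T[) dot (residual F f y w t) (linearization F y u t) <=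
  d%:R * mesh s ^+ 2 * norm_L2 T (rhs_deriv F f y) *
    (K * E * norm_L2 T (derive1 y) + L * norm_L2 T (derive1 u)).
Proof.
move=> T0 hs C1 Hf hy hu minw L0 K0 E0 uE hL hK.
have cF : continuous F by move=> x; exact/differentiable_continuous/C1.1.
have hw := minw.1.
have Hy := fe_space_in_H1 _ _ _ hs hy; have Hu := fe_space_in_H1 _ _ _ hs hu.
have Lr := rhs_deriv_in_L2 _ _ _ _ T0 C1 Hy Hf.
have mw := residual_measurable _ _ _ _ _ _ hs cF Hf Hy hw.
have [Mw Mw0 hMw] := residual_bounded _ _ _ _ _ _ T0 hs cF Hf Hy hw.
have mphi := linearization_measurable _ _ _ _ C1 Hy Hu.
have hphi t : t \in `]0, T[ -> enorm (linearization F y u t) <= L * E.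
  move=> /subset_itv_oo_cc tT; rewrite (le_trans (hL t (u t) tT))//.
  by rewrite ler_wpM2l// uE.
have i1 := integrable_dot_bounded _ _ _ _ _ mw mphi hMw hphi.
pose h_ (k : 'I_(size s)) := node s k.+1 - node s k.
have h0 k : 0 < h_ k by rewrite subr_gt0 (node_lt _ _ _ hs).
pose elt (p : R -> R) (k : 'I_(size s)) := \int[mu]_(t in `]node s k, node s k.+1[) p t.
(* The derivative is constant on an element, so half a power of the length converts its slope into a
   local L^2 norm, which can be summed by Cauchy-Schwarz. *)
have elE v : fe_space d T s v -> forall k : 'I_(size s),
    Num.sqrt (elt (fun t => enorm (derive1 v t) ^+ 2) k) =
    Num.sqrt (h_ k) * enorm (slope s v k).
  move=> hv k; rewrite -[enorm (slope s v k)]ger0_norm ?enorm_ge0// -sqrtr_sqr.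
  rewrite -sqrtrM ?(ltW (h0 k))//; congr Num.sqrt.
  rewrite /elt (_ : \int[mu]_(t in _) _ =
      \int[mu]_(t in `]node s k, node s k.+1[) (enorm (slope s v k) ^+ 2)).
    rewrite Rintegral_cst// mulrC; congr (_ * _).
    apply: (@eq_trans _ _ (fine (mu `]node s k, node s k.+1[))); first by [].
    by rewrite lebesgue_measure_oo// ltW// (node_lt _ _ _ hs).
  apply: eq_Rintegral => t; rewrite inE/= => tk.
  by have [_ ->] := fe_space_derive1 _ _ _ _ _ hs hv (ltn_ord k) tk.
pose N k := Num.sqrt (elt (fun t => enorm (rhs_deriv F f y t) ^+ 2) k).
pose P k := Num.sqrt (elt (fun t => enorm (derive1 y t) ^+ 2) k).
pose Q k := Num.sqrt (elt (fun t => enorm (derive1 u t) ^+ 2) k).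
have sumE v : in_L2 T v ->
    Num.sqrt (\sum_k Num.sqrt (elt (fun t => enorm (v t) ^+ 2) k) ^+ 2)
    = norm_L2 T v.
  move=> /in_L2_integrable[_ iv]; rewrite /norm_L2 (Rintegral_node_split _ _ _ hs iv).
  congr Num.sqrt; apply: eq_bigr => k _; rewrite sqr_sqrtr// Rintegral_ge0// => t _.
  exact: sqr_ge0.
have el k : elt (fun t => dot (residual F f y w t) (linearization F y u t)) k <=
    d%:R * mesh s ^+ 2 * (K * E * (N k * P k) + L * (N k * Q k)).
  have ks := ltn_ord k.
  have n0 := node_ge0 _ _ _ hs (ltnW ks); have nT := node_leT _ _ _ hs ks.
  have kk := node_lt _ _ _ hs ks.
  have tin t : t \in `[node s k, node s k.+1] -> t \in `[0, T].
    rewrite !in_itv/= => /andP[kt tk].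
    by rewrite (le_trans n0 kt) (le_trans tk nT).
  have kin : node s k \in `[node s k, node s k.+1] by rewrite in_itv/= lexx ltW.
  (* The oscillation is measured from the left node: the first term is the variation of [DF] along
     [y] in the direction [u (node s k)], the second is the variation of [u] under [DF (y t)]. *)
  pose B := h_ k * (K * E * enorm (slope s y k) + L * enorm (slope s u k)).
  have B0 : 0 <= B.
    by rewrite /B mulr_ge0 ?(ltW (h0 k))// addr_ge0// !mulr_ge0// enorm_ge0.
  have hB t : t \in `]node s k, node s k.+1[ ->
      enorm (linearization F y u t - linearization F y u (node s k)) <= B.
    move=> /subset_itv_oo_cc tk.
    have th : t - node s k <= h_ k.
      by move: tk; rewrite in_itv/= => /andP[_ tk]; rewrite lerD2r.
    have t0 : 0 <= t - node s k.
      by move: tk; rewrite in_itv/= => /andP[kt _]; rewrite subr_ge0.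
    have Du : enorm (u t - u (node s k)) <= h_ k * enorm (slope s u k).
      rewrite (fe_spaceE _ _ _ _ t hs hu ks tk) addrC addKr enormZ ger0_norm//.
      by rewrite ler_wpM2r// enorm_ge0.
    have Dy : enorm (y t - y (node s k)) <= h_ k * enorm (slope s y k).
      rewrite (fe_spaceE _ _ _ _ t hs hy ks tk) addrC addKr enormZ ger0_norm//.
      by rewrite ler_wpM2r// enorm_ge0.
    have -> : linearization F y u t - linearization F y u (node s k) =
        'D_(u t - u (node s k)) F (y t) +
        ('D_(u (node s k)) F (y t) - 'D_(u (node s k)) F (y (node s k))).
      rewrite /linearization [X in _ = X + _]deriveEjacobian; last exact: C1.1.
      rewrite mulmxBl -!deriveEjacobian; [|exact: C1.1..].
      by rewrite addrA subrK.
    rewrite (le_trans (enormD _ _))// /B mulrDr addrC lerD//.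
      rewrite (le_trans (hK _ _ _ (tin _ tk) (tin _ kin)))//.
      rewrite (_ : h_ k * (K * E * enorm (slope s y k)) =
        K * E * (h_ k * enorm (slope s y k))); last by ring.
      apply: ler_pM => //; [|exact: enorm_ge0|].
        by rewrite mulr_ge0 ?enorm_ge0.
      by rewrite ler_wpM2l// uE// tin.
    by rewrite (le_trans (hL _ _ (tin _ tk)))// mulrCA ler_wpM2l.
  have := residual_pairing T s F f g y w k _ _ B _ T0 hs C1 Hf Hy minw ks mphi hphi B0 hB.
  move=> /(le_trans (ler_norm _))/le_trans; apply.
  have hm : h_ k <= mesh s by exact: node_mesh.
  have Pk : P k = Num.sqrt (h_ k) * enorm (slope s y k) by exact: elE.
  have Qk : Q k = Num.sqrt (h_ k) * enorm (slope s u k) by exact: elE.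
  rewrite -/(h_ k) -/(N k) /B.
  rewrite (_ : h_ k * (d%:R * (Num.sqrt (h_ k) * N k) * _) =
    d%:R * h_ k ^+ 2 * (K * E * (N k * P k) + L * (N k * Q k))); last first.
    by rewrite Pk Qk; ring.
  rewrite ler_wpM2r//.
    by rewrite !(mulr_ge0, addr_ge0) ?sqrtr_ge0.
  rewrite ler_wpM2l// ler_pXn2r ?nnegrE ?mesh_ge0//; exact: ltW.
rewrite (Rintegral_node_split _ _ _ hs i1).
apply: (le_trans (ler_sum _ (fun k _ => el k))).
have [_ _ Ly] := Hy; have [_ _ Lu] := Hu.
have NP : \sum_k N k * P k <= norm_L2 T (rhs_deriv F f y) * norm_L2 T (derive1 y).
  rewrite -(sumE _ Lr) -(sumE _ Ly).
  exact: le_trans (ler_norm _) (sum_cauchy_schwarz N P).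
have NQ : \sum_k N k * Q k <= norm_L2 T (rhs_deriv F f y) * norm_L2 T (derive1 u).
  rewrite -(sumE _ Lr) -(sumE _ Lu).
  exact: le_trans (ler_norm _) (sum_cauchy_schwarz N Q).
have -> : \sum_(k < size s) d%:R * mesh s ^+ 2 *
      (K * E * (N k * P k) + L * (N k * Q k)) =
    d%:R * mesh s ^+ 2 * (K * E * (\sum_k N k * P k) + L * (\sum_k N k * Q k)).
  exact: sumr_affine_comb.
apply: ler_affine_comb NP NQ => //; first by rewrite mulr_ge0 ?sqr_ge0.
exact: mulr_ge0.
Qed.

End discrete_error.

(** * The error estimate *)

(** The bound sees [y] only through its distance to [u], hence is uniform over the discrete
    solutions in the ball. *)
Lemma norm_L2_derive1_le_ball {R : realType} {d : nat} (T : R)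
    (y u : R -> 'rV[R]_d) (r : R) : 0 <= r ->
  in_L2 T (derive1 y) -> in_L2 T (derive1 u) ->
  norm_L2 T (derive1 (y - u)) =
    norm_L2 T (fun t => derive1 y t - derive1 u t) ->
  norm_X T (y - u) < r ->
  norm_L2 T (derive1 y) <= Num.sqrt (2 * norm_X T u ^+ 2 + 2 * r ^+ 2).
Proof.
move=> r0 Ly Lu E hr.
rewrite -[leLHS]ger0_norm ?sqrtr_ge0// -sqrtr_sqr ler_wsqrtr//.
rewrite (le_trans (sqr_norm_L2_le _ _ _ Ly Lu))// -E lerD// ler_wpM2l//.
  by rewrite ler_pXn2r ?nnegrE ?sqrtr_ge0// norm_L2_derive1_le.
rewrite ler_pXn2r ?nnegrE ?sqrtr_ge0//.
by rewrite (le_trans (norm_L2_derive1_le _ _))// ltW.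
Qed.

Theorem proposition3p2 (R : realType) (d : nat) (T : R)
  (g : 'rV[R]_d) (f : R -> 'rV[R]_d) (F : 'rV[R]_d -> 'rV[R]_d)
  (ystar : R -> 'rV[R]_d) (s : nat -> seq R) (r hbar : R)
  (yh : nat -> R -> 'rV[R]_d)
  (hd : (0 < d)%N) (hT : 0 < T)
  (hf : in_H1 T f)
  (hF : class_C 3 F)
  (hystar : unique_on T
     [set y | strong_solution T g (fun t => F (y t) + f t) y] ystar)
  (hs : forall n, itv_partition 0 T (s n))
  (happrox : forall v : R -> 'rV[R]_d, in_H1 T v ->
     forall e, 0 < e -> exists2 delta, 0 < delta &
       forall n, 0 < mesh (s n) < delta ->
         norm_X T (v - proj_fe T (s n) v) < e)
  (hsmall : sup_jac F (ystar @` `[0, T]) <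
     (Num.sqrt (2 * T ^+ 2 + T + const_L2 d T ^+ 2 +
        Num.sqrt ((2 * T ^+ 2 + T + const_L2 d T ^+ 2) ^+ 2
                  + 2 * T * const_L2 d T ^+ 2 * (1 + 2 * T))))^-1)
  (hr : 0 < r) (hhbar : 0 < hbar)
  (hyh : forall n, 0 < mesh (s n) < hbar ->
     unique_on T
       (minimizer_on (fe_space d T (s n)) (J T F f g) `&` ball_X T ystar r)
       (yh n))
  (hlip : lip F (tube T ystar (const_max d T * r)) * T / Num.sqrt 2 < 1)
  (hjac : sup_jac F (tube T ystar (const_max d T * r)) < (const_L2 d T)^-1) :
  exists2 C : R, 0 < C &
    forall n, 0 < mesh (s n) < hbar ->
    forall w wh : R -> 'rV[R]_d,
      strong_solution T g (fun t => F (yh n t) + f t) w ->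
      minimizer_on (fe_space d T (s n)) (J_lin T F f g (yh n)) wh ->
      norm_X T (yh n - wh) <=
        C * norm_L2 T (derive1n 2 w)
        / (1 - const_L2 d T * sup_jac F (tube T ystar (const_max d T * r)))
        * mesh (s n) ^+ 2.
Proof.
have C2 := class_C2 _ _ hF.
have C1 := differentiable_C2W _ C2.
have cF : continuous F by move=> x; exact/differentiable_continuous/C2.1.
set cm := const_max d T in hlip hjac *; set c2 := const_L2 d T in hjac *.
set tb := tube T ystar (cm * r) in hlip hjac *.
set L := sup_jac F tb in hjac *.
have cm0 : 0 < cm by exact: const_max_gt0.
have c20 : 0 <= c2 by exact: const_L2_ge0.
have Sy : strong_solution T g (fun t => F (ystar t) + f t) ystar := hystar.1.
have [Hystar _ _] := Sy.
have [rho0 rho00 hrho0] := in_H1_bounded _ _ hT Hystar.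
(* The ball of this radius contains the tube and, unlike the tube, is evidently convex, as the mean
   value estimates for [DF] require. *)
pose rho := rho0 + cm * r.
have tbrho x : tb x -> enorm x <= rho.
  move=> [t tT /ltW hx]; rewrite -(subrK (ystar t) x) (le_trans (enormD _ _))//.
  by rewrite addrC lerD// hrho0.
have [K K0 hK] := derive_lipschitz_ball F rho C2.
have hL x v : tb x -> enorm ('D_v F x) <= L * enorm v.
  by move=> tx; exact: derive_le_sup_jac C1 tbrho tx.
have L0 : 0 <= L.
  pose v : 'rV[R]_d := delta_mx ord0 (Ordinal hd).
  have v0 : 0 < enorm v.
    rewrite (lt_le_trans _ (abs_coord_le_enorm v (Ordinal hd)))//.
    by rewrite mxE !eqxx normr1.
  have ty : tb (ystar 0).
    exists 0; first by rewrite /= in_itv/= lexx ltW.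
    by rewrite /= subrr enorm0 mulr_gt0.
  by rewrite -(pmulr_lge0 _ v0) (le_trans (enorm_ge0 _) (hL _ v ty)).
(* The inverse of 0 is 0 by convention, so the hypothesis on [L] can be multiplied out only for
   nonzero [c2]. *)
have c2L : 0 < 1 - c2 * L.
  rewrite subr_gt0; have [->|c2n] := eqVneq c2 0; first by rewrite mul0r.
  by rewrite -ltr_pdivlMl ?mulr1// lt_neqAle eq_sym c2n.
pose Y := Num.sqrt (2 * norm_X T ystar ^+ 2 + 2 * r ^+ 2).
have Y0 : 0 <= Y by exact: sqrtr_ge0.
have C0 : 0 <= d%:R * (K * cm * Y + L).
  by rewrite mulr_ge0// addr_ge0// !mulr_ge0// ltW.
(* [K] is the Lipschitz constant of [DF] on the ball of radius [rho], [cm] converts the maximum of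
   the error into its X norm, and [Y] bounds the derivative of the discrete solution. The added 1
   makes the constant positive. *)
exists (d%:R * (K * cm * Y + L) + 1); first by rewrite ltr_wpDl.
move=> n hn w wh Sw minw.
have [[miny [Hy yr]] _] := hyh n hn.
have hsn := hs n; have hy := miny.1; have hw := minw.1.
have dystar t : t \in `]0, T[ -> derivable ystar t 1.
  by move=> tT; have [] := strong_solution_derive1 _ _ _ _ _ _ hT cF Hystar hf Sy t tT.
(* [ystar] is differentiable at every interior point, its equation having a continuous right-hand
   side. Exceptional points are thus nodes, and the exceptional set is finite. *)
have [] := in_H1B T (yh n) ystar [set` s n] _ Hy Hystar.
- exact: finite_set_countable.
- move=> t tT /negP ts; split; last exact: dystar.
  have [k ks tk] := node_locate_notin _ _ _ hsn tT ts.
  by have [] := fe_space_derive1 _ _ _ _ _ hsn hy ks tk.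
move=> Hd Ed.
have [_ _ Ly] := Hy; have [_ _ Lystar] := Hystar.
have yY := norm_L2_derive1_le_ball T _ _ r (ltW hr) Ly Lystar Ed yr.
(* The radius [cm * r] of the tube is exactly the maximum-norm bound for differences of X norm below
   [r]. *)
have ytb t : t \in `[0, T] -> tb (yh n t).
  move=> tT; exists t => //=.
  have := enorm_le_const_max _ _ _ hT Hd tT; rewrite -/cm => h.
  by rewrite (le_lt_trans h)// ltr_pM2l.
have he : fe_space d T (s n) (yh n - wh) by exact: fe_spaceB hy hw.
have He := fe_space_in_H1 _ _ _ hsn he.
set e := yh n - wh in he He *.
have X0 := norm_X_ge0 T e.
have eE t : t \in `[0, T] -> enorm (e t) <= cm * norm_X T e.
  by move=> tT; exact: enorm_le_const_max.
have en := energy_identity _ _ _ _ _ _ _ hT hsn C2 hf miny minw.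
have b1 : \int[lebesgue_measure]_(t in `]0, T[)
    dot (derive1 e t) (linearization F (yh n) e t) <= c2 * L * norm_X T e ^+ 2.
  apply: linearization_L2_le => //.
    by move=> t /subset_itv_oo_cc tT; apply: hL; exact: ytb.
  by have [M _ hM] := fe_space_derive1_bounded _ _ _ hsn he; exists M.
have b2 := residual_linearization_le T (s n) F f g (yh n) wh e L K (cm * norm_X T e)
  hT hsn C1 hf hy he minw L0 K0 (mulr_ge0 (ltW cm0) X0) eE
  (fun t v tT => hL _ v (ytb t tT))
  (fun t t' v tT tT' => hK _ _ v (tbrho _ (ytb t tT)) (tbrho _ (ytb t' tT'))).
rewrite (strong_solution_norm_derive2 _ _ _ _ _ _ hT C1 Hy hf Sw).
have V0 : 0 <= norm_L2 T (rhs_deriv F f (yh n)) by exact: sqrtr_ge0.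
have h0 := mesh_ge0 (s n).
have eX := norm_L2_derive1_le T e.
move: en b1 b2 yY eX X0 V0; rewrite -/e -/Y.
move: (norm_X T e) (norm_L2 T (derive1 e)) (norm_L2 T (rhs_deriv F f (yh n)))
  (norm_L2 T (derive1 (yh n))) => X De V Dy.
set I1 := Rintegral _ _ _; set I2 := Rintegral _ _ _ => en b1 b2 yY eX X0 V0.
have hV : 0 <= d%:R * mesh (s n) ^+ 2 * V by rewrite !mulr_ge0 ?sqr_ge0.
have b3 : I2 <= (d%:R * (K * cm * Y + L)) * V * mesh (s n) ^+ 2 * X.
  rewrite (le_trans b2)//.
  rewrite [leRHS](_ : _ =
    d%:R * mesh (s n) ^+ 2 * V * (K * (cm * X) * Y + L * X)); last by ring.
  rewrite ler_wpM2l// lerD// ler_wpM2l//.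
  by rewrite mulr_ge0// mulr_ge0// ltW.
rewrite -mulrA -mulrA (mulrC _^-1) mulrA mulrA ler_pdivlMr//.
(* The energy estimate is quadratic in [X] on the left and linear on the right; one factor [X] is
   cancelled when it is nonzero. *)
have [->|Xn] := eqVneq X 0.
  by rewrite mul0r !mulr_ge0 ?sqr_ge0// addr_ge0.
have Xp : 0 < X by rewrite lt_neqAle eq_sym Xn.
rewrite -(ler_pM2l Xp).
have -> : X * (X * (1 - c2 * L)) = X ^+ 2 - c2 * L * X ^+ 2 by ring.
have p0 : 0 <= X * (V * mesh (s n) ^+ 2) by rewrite !mulr_ge0 ?sqr_ge0.
move: b3 p0; set D := d%:R * _; set h2 := mesh _ ^+ 2 => b3 p0.
have -> : X * ((D + 1) * V * h2) = D * V * h2 * X + X * (V * h2) by ring.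
lra.
Qed.
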